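(* Let $d\ge 3$ be an integer and let $\nabla K(x)=x|x|^{\alpha-2}$ on $\mathbb{R}^d$. Assume that either $\alpha\in[5-d,2)$ (and thus $d\ge 4$) or $\alpha=4-d$. Then any radially symmetric first-kind similarity measure solution $(\mu_t)$ of the aggregation equation $u_t+\operatorname{div}(uv)=0$, $v=-\nabla K*u$, is of the form $$\mu_t(x)=\frac{1}{R(t)^d}\,\mu_0\!\left(\frac{x}{R(t)}\right),$$ where $$\hat\mu_0=m_0\delta_0+m_1\delta_{\rho_1}$$ for some constants $m_0,m_1\ge 0$ and $\rho_1>0$.
   Context: Aggregation equation: $u_t+\operatorname{div}(uv)=0$, $v=-\nabla K*u$ for $x\in\mathbb{R}^d$, $t>0$, with $\nabla K(x)=x|x|^{\alpha-2}$. Let $\mathscr{P}(\mathbb{R}^d)$ be the set of probability measures on $\mathbb{R}^d$. For a radially symmetric $\mu\in\mathscr{P}(\mathbb{R}^d)$, $\hat\mu\in\mathscr{P}([0,\infty))$ is defined by $\hat\mu(I)=\mu(\{x\in\mathbb{R}^d:|x|\in I\})$ for all Borel sets $I\subset[0,\infty)$. The notation $\mu_t(x)=R(t)^{-d}\mu_0(x/R(t))$ means that $\mu_t$ is the push-forward of $\mu_0$ under the dilation $x\mapsto R(t)x$. Velocity of a radially symmetric measure: for radially symmetric $\mu\in\mathscr{P}(\mathbb{R}^d)$ and $x\neq 0$, the velocity $-\nabla K*\mu$ at $x$ is $$V[\mu](x)=-\int_{\mathbb{R}^d}(x-y)|x-y|^{\alpha-2}\,d\mu(y)=-\left(\int_{[0,\infty)}\phi(|x|/\rho)\rho^{\alpha-1}\,d\hat\mu(\rho)\right)\frac{x}{|x|},$$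 where $\phi(r)$, $r\ge 0$, is the average over the unit sphere $S_1=\{y\in\mathbb{R}^d:|y|=1\}$ (with respect to normalized surface measure) of $\frac{r-y_1}{|re_1-y|^{2-\alpha}}$, $e_1=(1,0,\dots,0)$; at $\rho=0$ the integrand is understood as $|x|^{\alpha-1}$ (the contribution of a mass at the origin). At the origin $V[\mu](0)=0$ by symmetry. A radially symmetric first-kind similarity measure solution is a family $\mu_t$ of the form $\mu_t(x)=R(t)^{-d}\mu_0(x/R(t))$, where $\mu_0\in\mathscr{P}(\mathbb{R}^d)$ is radially symmetric and $R>0$ is a differentiable function on a time interval $[0,T_0)$ with $R(0)=1$, such that for every $x\in\operatorname{supp}\mu_0$ the flow map of the velocity field $v(t,\cdot)=V[\mu_t]$ (assumed finite on $\operatorname{supp}\mu_t$) starting at $x$ equals $R(t)x$ at time $t$, i.e. $\frac{d}{dt}(R(t)x)=v(t,R(t)x)$. In particular $V[\mu_0](x)=-\lambda x$ on $\operatorname{supp}\mu_0$ with some constant $\lambda>0$, and, if $\mu_0\ne\delta_0$, $R(t)=(1-t/T_0)^{1/(2-\alpha)}$ with $T_0=(2-\alpha)^{-1}\lambda^{-1}$. *)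

(* Defs.v *)
From mathcomp Require Import all_boot all_order all_algebra.
From mathcomp Require Import all_classical all_reals all_analysis.
From mathcomp Require Import measurable_realfun.

Set Implicit Arguments.
Unset Strict Implicit.
Unset Printing Implicit Defensive.

Import Order.TTheory GRing.Theory Num.Theory.
Import numFieldNormedType.Exports.

Local Open Scope classical_set_scope.
Local Open Scope ring_scope.

(* R^d with its Borel sigma-algebra. *)
Notation Rd R d := (g_sigma_algebraType (@open 'rV[R]_d)).

Section Definitions.
Context {R : realType} {d : nat}.
Implicit Types (alpha : R) (x y v : 'rV[R]_d) (mu : probability (Rd R d) R).

(* The Euclidean norm; the library norm `|x| of 'rV[R]_d is the sup norm. *)
Definition enorm x : R := Num.sqrt (\sum_(i < d) x 0 i ^+ 2).

(* At z = 0 the value is 0 for every alpha, even where the kernel is singular.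
   This is harmless: in [has_velocity] it matters only if mu has an atom at
   x <> 0, which a radially symmetric measure has not (for d >= 2). *)
Definition gradK alpha (z : 'rV[R]_d) : 'rV[R]_d :=
  (enorm z `^ (alpha - 2)) *: z.

Definition radially_symmetric mu : Prop :=
  forall Q : 'M[R]_d, Q *m Q^T = 1%:M ->
  forall A : set (Rd R d), measurable A ->
    mu [set y : Rd R d | A ((y : 'rV[R]_d) *m Q)] = mu A.

(* The measure mu-hat on [0, +oo[. *)
Definition radial_part mu : set R -> \bar R :=
  pushforward mu (enorm : Rd R d -> R).

Definition supp mu : set 'rV[R]_d :=
  [set x | forall U : set 'rV[R]_d, open U -> U x -> (0 < mu U)%E].

Definition cball (M : R) : set (Rd R d) := [set y | enorm y <= M].

(* V[mu](x) exists and equals v, where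
     V[mu](x) = - \int (x - y) |x - y|^(alpha - 2) dmu(y).
   The integral over R^d is taken as the limit of the (absolutely convergent)
   integrals over the balls |y| <= M as M tends to infinity.  It is the Lebesgue
   integral whenever the integrand is mu-integrable, see
   [has_velocity_integrable].  For a radially symmetric mu the integral over
   |y| <= M is that of phi(|x|/rho) rho^(alpha-1) against mu-hat over [0, M],
   times x/|x|, so the limit agrees with the radial formula for V[mu] also when
   alpha > 1 and mu has an infinite moment of order alpha - 1, where the
   d-dimensional integral is not absolutely convergent but the radial one is. *)
Definition has_velocity alpha mu x v : Prop :=
  if x == 0 then v = 0 else
  forall i : 'I_d,
    (forall M : R,
       mu.-integrable (cball M)
         (fun y : Rd R d => (gradK alpha (x - y) 0 i)%:E)) /\
    (fun M : R => - \int[mu]_(y in cball M) (gradK alpha (x - y) 0 i)) @ +oo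
      --> v 0 i.

Definition time_interval (T0 : \bar R) : set R :=
  [set t | 0 <= t /\ (t%:E < T0)%E].

(* Derivative at t of a curve defined on D (one-sided at an endpoint of D). *)
Definition has_derivative_within (V : normedModType R) (D : set R)
    (f : R -> V) (t : R) (l : V) : Prop :=
  (s - t)^-1 *: (f s - f t) @[s --> within D t^'] --> l.

Definition is_dilation (c : R) mu0 mu : Prop :=
  forall A : set (Rd R d), measurable A ->
    mu A = mu0 [set y : Rd R d | A (c *: (y : 'rV[R]_d))].

(* X is a trajectory, on [0, T0[, of the velocity field w, starting from x. *)
Definition is_trajectory (T0 : \bar R) (w : R -> 'rV[R]_d -> 'rV[R]_d)
    x (X : R -> 'rV[R]_d) : Prop :=
  X 0 = x /\
  forall t, time_interval T0 t ->
    has_derivative_within (time_interval T0) X t (w t (X t)).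

(* mu t is the solution at time t in [0, T0[ and r t is the dilation factor. *)
Definition radial_first_kind_similarity_solution alpha (T0 : \bar R)
    (r : R -> R) (mu : R -> probability (Rd R d) R) : Prop :=
  [/\ (0 < T0)%E,
      [/\ r 0 = 1,
          forall t, time_interval T0 t -> 0 < r t &
          forall t, time_interval T0 t ->
            exists l : R, has_derivative_within (time_interval T0)
                            (r : R -> R^o) t l],
      radially_symmetric (mu 0),
      forall t, time_interval T0 t -> is_dilation (r t) (mu 0) (mu t) &
      exists w : R -> 'rV[R]_d -> 'rV[R]_d,
        (forall t, time_interval T0 t -> forall x, supp (mu t) x ->
           has_velocity alpha (mu t) x (w t x)) /\
        (forall x, supp (mu 0) x ->
           is_trajectory T0 w x (fun t => r t *: x))].

Lemma enorm_continuous : continuous (enorm : 'rV[R]_d -> R).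
Proof.
move=> x; apply: (@continuous_comp _ _ _
    (fun y : 'rV[R]_d => \sum_(i < d) y 0 i ^+ 2) (@Num.sqrt R));
  last exact: sqrt_continuous.
apply: continuous_big => [|i _ y]; first exact: add_continuous.
apply: (@continuous_comp _ _ _ (fun z : 'rV[R]_d => z 0 i)
  (fun u : R => u ^+ 2)); first exact: coord_continuous.
exact: exprn_continuous.
Qed.

Lemma measurable_cball (M : R) : measurable (cball M).
Proof.
rewrite -[cball M]setCK; apply: measurableC; apply: sub_sigma_algebra.
apply: closed_openC; apply: (@preimage_closed 'rV[R]_d R enorm [set u | u <= M]).
  by move=> x _; exact: enorm_continuous.
exact: closed_le.
Qed.

Lemma has_velocity_integrable alpha mu x : x != 0 ->
  (forall i, mu.-integrable setT
     (fun y : Rd R d => (gradK alpha (x - y) 0 i)%:E)) ->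
  has_velocity alpha mu x
    (- \row_i \int[mu]_(y in [set: Rd R d]) (gradK alpha (x - y) 0 i)).
Proof.
move=> x0 intf; rewrite /has_velocity (negbTE x0) => i; split.
  move=> M; apply: integrableS (intf i) => //; exact: measurable_cball.
rewrite !mxE; apply: cvgN; apply/cvg_pinftyP => u uy.
set f : Rd R d -> R := fun y => gradK alpha (x - y) 0 i.
have mf : measurable_fun [set: Rd R d] (EFin \o f) by have /integrableP[] := intf i.
pose g n := (EFin \o f) \_ (cball (u n)).
have mg n : measurable_fun [set: Rd R d] (g n).
  apply/(measurable_restrictT _ (measurable_cball (u n))).
  exact: measurable_funS mf.
have gf y : setT y -> g n y @[n --> \oo] --> (EFin \o f) y.
  move=> _; apply: cvg_near_cst.
  near=> n; rewrite /g patchE mem_set// /cball/=.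
  by near: n; apply: cvgry_ge.
have H : (\int[mu]_(y in setT) g n y)%E @[n --> \oo] -->
    (\int[mu]_(y in setT) (EFin \o f) y)%E.
  apply: (@dominated_cvg _ _ _ mu setT measurableT g (EFin \o f)
    (abse \o (EFin \o f)) mg gf) => //.
  - exact: integrable_abse (intf i).
  - move=> n y _; rewrite /g patchE; case: ifPn => // _.
    by rewrite abse0 abse_ge0.
rewrite /Rintegral -/f; apply: fine_cvg.
rewrite fineK; last exact: integrable_fin_num (intf i).
under eq_fun do rewrite integral_mkcond.
exact: H.
Unshelve. all: by end_near. Qed.

End Definitions.

(* Main.v *)
(* Write d = n + 1 and b = (alpha - 2) / 2.  On a ray through the support, the
   radial speed divided by the radius s, call it h(s), takes the same value at all
   radii charged by mu_0, so it suffices to show that h is strictly decreasing in a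
   suitable sense.  With D = |s e_1 - y|^2 + e, rotation invariance of mu (in its
   infinitesimal form: derivatives along plane rotations integrate to 0) gives, for
     m_g(s) = int D^g dmu(y),   n_g(s) = int D^g (s - y_1) dmu(y)
   on any bounded shell, the closed system
     m_g' = 2 g n_(g-1),   (s^n n_g)' = s^n ((d + 2 g) m_g - 2 g e m_(g-1)),
   so no surface measure is needed.  For e > 0 all integrals are regular, and
   d + 2 b >= 2 makes the bilaplacian of the regularised potential nonpositive;
   hence u, the averaged Laplacian, and then h = n_b / s, an average of u, are
   nonincreasing.  Dominated convergence as e -> 0 yields the weak inequality for
   the singular kernel.  It is strict for the mass inside a ball of radius a at
   radii beyond a, since there u' < 0 pointwise.  If the support met two positive
   radii r < t, splitting mu at some a between them would give h(r) > h(t). *)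
Require Import Defs.
From mathcomp Require Import all_boot all_order all_algebra.
From mathcomp Require Import all_classical all_reals all_analysis.
From mathcomp Require Import measurable_realfun.
From mathcomp Require Import ring lra.

Import Order.TTheory GRing.Theory Num.Theory.
Import numFieldNormedType.Exports.

Local Open Scope classical_set_scope.
Local Open Scope ring_scope.

(** * Euclidean norm, measurability and invariance of integrals *)

Section EuclideanSpace.
Context {R : realType} {d : nat}.
Implicit Types (x y : 'rV[R]_d) (Q : 'M[R]_d).

Lemma continuous_measurable_rV (f : 'rV[R]_d -> R) :
  continuous f -> measurable_fun [set: Rd R d] (f : Rd R d -> R).
Proof.
move=> /continuousP cf; apply: (measurability _ (RGenOpens.measurableE R)).
move=> _ [_ [a [b ->] <-]]; rewrite setTI; apply: sub_sigma_algebra.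
exact/cf/interval_open.
Qed.

Lemma measurable_coord (i : 'I_d) :
  measurable_fun [set: Rd R d] (fun y : Rd R d => (y : 'rV[R]_d) 0 i).
Proof.
exact: (@continuous_measurable_rV (fun y : 'rV[R]_d => y 0 i) (@coord_continuous R 1 d 0 i)).
Qed.

Lemma measurable_enorm : measurable_fun [set: Rd R d] (enorm : Rd R d -> R).
Proof. exact: (@continuous_measurable_rV enorm (@enorm_continuous R d)). Qed.

Lemma mulmx_continuous Q : continuous (fun y => y *m Q).
Proof.
rewrite (_ : (fun y => _) = fun y => \sum_i y 0 i *: row i Q); last first.
  by apply/funext => y; rewrite mulmx_sum_row.
apply: continuous_big => [|i _ y]; first exact: add_continuous.
apply: (@continuous_comp _ _ _ (fun z : 'rV[R]_d => z 0 i) (fun k => k *: row i Q)).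
  exact: coord_continuous.
exact: scalel_continuous.
Qed.

Lemma measurable_mulmx Q :
  measurable_fun [set: Rd R d] (fun y : Rd R d => (y : 'rV[R]_d) *m Q : Rd R d).
Proof.
apply: (@measurability _ _ (Rd R d) (Rd R d) _ _ (@open 'rV[R]_d) erefl).
move=> _ [U oU <-]; rewrite setTI; apply: sub_sigma_algebra.
by move/continuousP: (mulmx_continuous Q); apply.
Qed.

Lemma enorm_ge0 x : 0 <= enorm x.
Proof. exact: sqrtr_ge0. Qed.

Lemma sqr_enorm x : enorm x ^+ 2 = \sum_(i < d) x 0 i ^+ 2.
Proof. by rewrite sqr_sqrtr// sumr_ge0// => i _; exact: sqr_ge0. Qed.

Lemma sqr_enormE x : enorm x ^+ 2 = (x *m x^T) 0 0.
Proof. by rewrite sqr_enorm mxE; apply: eq_bigr => i _; rewrite mxE expr2. Qed.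

Lemma coord_le_enorm x i : `|x 0 i| <= enorm x.
Proof.
rewrite -(@ler_pXn2r _ 2)// ?nnegrE ?enorm_ge0// sqr_enorm.
by rewrite real_normK ?num_real// (bigD1 i)//= lerDl sumr_ge0// => j _; exact: sqr_ge0.
Qed.

Lemma enorm_mulmx x Q : Q *m Q^T = 1%:M -> enorm (x *m Q) = enorm x.
Proof.
move=> QQ; apply/eqP; rewrite -(@eqrXn2 _ 2) ?enorm_ge0//; apply/eqP.
by rewrite !sqr_enormE trmx_mul mulmxA -(mulmxA x) QQ mulmx1.
Qed.

Lemma enorm_eq0 x : (enorm x == 0) = (x == 0).
Proof.
apply/eqP/eqP => [x0|->]; last first.
  by rewrite /enorm big1 ?sqrtr0// => i _; rewrite mxE expr0n.
apply/rowP => i; rewrite mxE; apply/eqP; rewrite -normr_eq0 eq_le normr_ge0 andbT.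
by rewrite -x0 coord_le_enorm.
Qed.

Context (mu : probability (Rd R d) R) (mur : radially_symmetric mu).

(** Radial symmetry says that [mu] equals its push-forward under y |-> y Q, so this is a change of
    variables. *)
Lemma Rintegral_mulmx Q (A : set (Rd R d)) (f : Rd R d -> R) :
  Q *m Q^T = 1%:M -> measurable A ->
  (forall y : Rd R d, A ((y : 'rV[R]_d) *m Q) <-> A y) ->
  measurable_fun setT f ->
  mu.-integrable A (EFin \o (fun y : Rd R d => f ((y : 'rV[R]_d) *m Q))) ->
  \int[mu]_(y in A) f ((y : 'rV[R]_d) *m Q) = \int[mu]_(y in A) f y.
Proof.
move=> QQ mA AQ mf intf; rewrite /Rintegral.
have AQE : (fun y : Rd R d => (y : 'rV[R]_d) *m Q : Rd R d) @^-1` A = A.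
  by apply/seteqP; split => y /AQ.
congr fine.
transitivity (\int[pushforward mu (fun y : Rd R d => (y : 'rV[R]_d) *m Q : Rd R d)]_(y in A)
   (EFin \o f) y)%E.
  by rewrite integral_pushforward ?AQE//; [exact: measurable_mulmx|exact/measurable_EFinP].
apply: eq_measure_integral; first exact: measurable_mulmx.
by move=> ? B mB _; exact: (mur Q QQ B mB).
Qed.

End EuclideanSpace.

(** * Plane rotations, and transitivity on spheres *)

Section OrthogonalMatrices.
Context {R : realType} {d : nat}.
Implicit Types (x y : 'rV[R]_d).

(** Written as 1 + (cos t - 1) P + sin t J, with P the projection on the plane and J the quarter
    turn in it: orthogonality then follows from the products of P and J alone. *)
Definition plane_rot (i j : 'I_d) (t : R) : 'M[R]_d :=
  1%:M + (cos t - 1) *: (delta_mx i i + delta_mx j j)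
       + sin t *: (delta_mx i j - delta_mx j i).

Lemma plane_rot_orthogonal i j t : i != j ->
  plane_rot i j t *m (plane_rot i j t)^T = 1%:M.
Proof.
move=> ij; rewrite /plane_rot.
set P := delta_mx i i + _; set J := delta_mx i j - _.
have PT : P^T = P by rewrite raddfD/= !trmx_delta.
have JT : J^T = - J by rewrite raddfB/= !trmx_delta opprB.
have E (a b c e : 'I_d) : delta_mx a b *m delta_mx c e = (b == c)%:R *: delta_mx a e :> 'M[R]_d.
  have [->|bc] := eqVneq b c; first by rewrite mul_delta_mx scale1r.
  by rewrite mul_delta_mx_0// scale0r.
have ji : (j == i) = false by rewrite eq_sym (negbTE ij).
have PP : P *m P = P.
  by rewrite /P mulmxDl !mulmxDr !E !eqxx ji (negbTE ij) !scale1r !scale0r addr0 add0r.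
have PJ : P *m J = J.
  by rewrite /P /J mulmxDl !mulmxBr !E !eqxx ji (negbTE ij) !scale1r !scale0r subr0 add0r.
have JP : J *m P = J.
  by rewrite /P /J mulmxBl !mulmxDr !E !eqxx ji (negbTE ij) !scale1r !scale0r addr0 add0r.
have JJ : J *m J = - P.
  rewrite /P /J mulmxBl !mulmxBr !E !eqxx ji (negbTE ij) !scale1r !scale0r.
  by rewrite subr0 sub0r opprD.
clearbody P J.
rewrite !raddfD/= trmx1 !linearZ/= PT JT.
rewrite mulmx1 mulmxN !mulmxDl !mul1mx -!scalemxAl PP PJ JP JJ.
apply/matrixP => a b; rewrite !mxE.
set c := cos t - 1; set s := sin t.
transitivity ((a == b)%:R + P a b * (c * c + s * s + (c + c))); first by ring.
have -> : c * c + s * s = - (c + c).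
  have := cos2Dsin2 t; rewrite /c /s.
  by move/eqP; rewrite -(subr_eq0 _ 1) => /eqP h; apply/eqP; rewrite -subr_eq0 -[X in _ == X]h; apply/eqP; ring.
by rewrite addNr mulr0 addr0.
Qed.

Lemma mulmx_plane_rotE y i j t k : i != j ->
  (y *m plane_rot i j t) 0 k =
    if k == i then y 0 i * cos t - y 0 j * sin t
    else if k == j then y 0 i * sin t + y 0 j * cos t else y 0 k.
Proof.
move=> ij; have E a b : (y *m delta_mx a b) 0 k = y 0 a * (k == b)%:R.
  rewrite mxE (bigD1 a)//= mxE eqxx/= big1 ?addr0// => l la.
  by rewrite mxE (negbTE la) mulr0.
rewrite /plane_rot !mulmxDr -!scalemxAr !mulmxDr mulmx1 mulmxN.
move: (E i i) (E j j) (E i j) (E j i).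
move: (y *m delta_mx i i) (y *m delta_mx j j) (y *m delta_mx i j) (y *m delta_mx j i).
move=> A B C D EA EB EC ED; rewrite !mxE {}EA {}EB {}EC {}ED.
case: eqVneq => [->|ki]; first by rewrite (negbTE ij) /=; ring.
by case: eqVneq => [->|kj] /=; ring.
Qed.

(* The Householder reflection in the hyperplane orthogonal to [x - y]. *)
Lemma orthogonal_transitive x y : enorm x = enorm y ->
  exists2 Q : 'M[R]_d, Q *m Q^T = 1%:M & x *m Q = y.
Proof.
move=> xy; have [->|xNy] := eqVneq x y.
  by exists 1%:M; rewrite ?trmx1 ?mulmx1.
pose v := x - y; pose q := enorm v ^+ 2.
have vT : v^T = x^T - y^T by rewrite raddfB.
have q0 : q != 0 by rewrite sqrf_eq0 enorm_eq0 subr_eq0.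
have vv : v *m v^T = q%:M.
  by apply/matrixP => i j; rewrite !ord1 [RHS]mxE eqxx mulr1n -sqr_enormE.
(* As |x| = |y|, the square |x - y|^2 is twice the inner product of x and x - y. *)
have xv : x *m v^T = (q / 2)%:M.
  apply/matrixP => i j; rewrite !ord1 [RHS]mxE eqxx mulr1n.
  have := sqr_enormE x; rewrite xy sqr_enormE => yx.
  have -> : q = (x *m x^T) 0 0 - (x *m y^T) 0 0 - (y *m x^T) 0 0 + (y *m y^T) 0 0.
    rewrite /q sqr_enormE vT mulmxBr !mulmxBl.
    move: (x *m x^T) (x *m y^T) (y *m x^T) (y *m y^T) => a b c e.
    by rewrite !mxE; ring.
  rewrite vT mulmxBr.
  have -> : y *m x^T = x *m y^T.
    by rewrite -[LHS]trmxK trmx_mul trmxK; apply/matrixP => a b; rewrite !ord1 mxE.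
  move: yx; move: (x *m x^T) (x *m y^T) (y *m y^T) => a b c yx.
  by rewrite !mxE yx; field.
exists (1%:M - (2 / q) *: (v^T *m v)).
  have PT : (v^T *m v)^T = v^T *m v by rewrite trmx_mul trmxK.
  have PP : (v^T *m v) *m (v^T *m v) = q *: (v^T *m v).
    by rewrite mulmxA -(mulmxA _ v) vv -scalemx1 -scalemxAr mulmx1 -scalemxAl.
  move: (v^T *m v) PT PP => P PT PP.
  have -> : (1%:M - (2 / q) *: P)^T = 1%:M - (2 / q) *: P.
    by apply/matrixP => i j; rewrite !mxE -{1}PT mxE eq_sym.
  rewrite mulmxBl !mulmxBr !mul1mx !mulmx1 -scalemxAl -scalemxAr PP.
  by apply/matrixP => i j; rewrite !mxE; field.
rewrite mulmxBr mulmx1 -scalemxAr mulmxA xv -scalemx1 -scalemxAl mul1mx scalerA.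
have -> : 2 / q * (q / 2) = 1 by field.
by rewrite scale1r /v subKr.
Qed.

End OrthogonalMatrices.

(** * One-variable derivatives and monotonicity *)

Section Calculus.
Context {R : realType}.
Implicit Types (f : R -> R) (x g : R).

Lemma is_derive_powR f x df g : 0 < f x -> is_derive x 1 f df ->
  is_derive x 1 (fun t => f t `^ g) (g * f x `^ (g - 1) * df).
Proof.
move=> fx0 fdf.
have fx : f x \in `]0, +oo[ by rewrite in_itv/= andbT.
have Df : is_derive (f x) 1 (@powR R ^~ g) (g * f x `^ (g - 1)).
  apply: DeriveDef; first exact: (@derivable_powR R 1 g (f x) fx).
  by rewrite -derive1E (powR_derive1 _ fx).
exact: (@is_derive1_comp _ (@powR R ^~ g) f).
Qed.

Lemma is_derive_lincomb (a b x df1 df2 : R) f1 f2 :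
  is_derive x 1 f1 df1 -> is_derive x 1 f2 df2 ->
  is_derive x 1 (fun t => a * f1 t - b * f2 t) (a * df1 - b * df2).
Proof.
move=> d1 d2; have ca := is_derive_cst a x (1 : R).
have cb := is_derive_cst b x (1 : R).
apply: (is_derive_eq (is_deriveB (is_deriveM ca d1) (is_deriveM cb d2))).
by rewrite /GRing.scale/= !mulr0 !addr0.
Qed.

Lemma is_derive_exprn n x : is_derive x 1 (fun t : R => t ^+ n) (n%:R * x ^+ n.-1).
Proof.
have H := is_deriveX n (is_derive_id x (1 : R)).
rewrite (_ : (fun t => _) = @id R ^+ n).
  by apply: (is_derive_eq H); rewrite /GRing.scale/= mulr1.
by apply/funext => t; rewrite exprfctE.
Qed.

Lemma is_derive_exprnM n x df f : is_derive x 1 f df ->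
  is_derive x 1 (fun t => t ^+ n * f t) (n%:R * x ^+ n.-1 * f x + x ^+ n * df).
Proof.
move=> fdf; apply: (is_derive_eq (is_deriveM (is_derive_exprn n x) fdf)).
by rewrite /GRing.scale/= addrC [f x * _]mulrC.
Qed.

Lemma MVT_is_derive (a b : R) f df : a < b ->
  (forall x, a <= x -> x <= b -> is_derive x 1 f (df x)) ->
  exists c, [/\ a < c, c < b & f b - f a = df c * (b - a)].
Proof.
move=> ab fdf.
have fd x : x \in `]a, b[ -> is_derive x 1 f (df x).
  by rewrite in_itv/= => /andP[ax xb]; apply: fdf; exact: ltW.
have cf : {within `[a, b], continuous f}.
  apply: derivable_within_continuous => x; rewrite in_itv/= => /andP[ax xb].
  by have [] := fdf x ax xb.
have [c + E] := MVT ab fd cf.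
by rewrite in_itv/= => /andP[ac cb]; exists c.
Qed.

Lemma is_derive_ge0_le (a b : R) f df : a <= b ->
  (forall x, a <= x -> x <= b -> is_derive x 1 f (df x)) ->
  (forall x, a < x -> x < b -> 0 <= df x) -> f a <= f b.
Proof.
rewrite le_eqVlt => /predU1P[->//|ab] fdf df0.
have [c [ac cb E]] := MVT_is_derive _ _ _ _ ab fdf.
by rewrite -subr_ge0 E mulr_ge0 ?df0// subr_ge0 ltW.
Qed.

End Calculus.

(** * Differentiation under the integral sign *)

Section IntegralCalculus.
Context {R : realType} {d} {T : measurableType d} (mu : probability T R).
Variables (A : set T) (mA : measurable A).

Lemma bounded_integrable (f : T -> R) (C : R) :
  measurable_fun setT f -> (forall y, A y -> `|f y| <= C) ->
  mu.-integrable A (EFin \o f).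
Proof.
move=> mf fC; apply: measurable_bounded_integrable => //.
- by rewrite (le_lt_trans (probability_le1 mu mA))// ltry.
- exact: measurable_funTS.
- exists C; split; first exact: num_real.
  by move=> x Cx y Ay /=; rewrite (le_trans (fC y Ay))// ltW.
Qed.

Lemma is_derive_Rintegral (f df : R -> T -> R) (a u v C : R) :
  u < a -> a < v ->
  (forall x, measurable_fun setT (f x)) ->
  (forall x y, u < x -> x < v -> A y -> `|f x y| <= C) ->
  (forall x y, u < x -> x < v -> A y -> is_derive x 1 (f ^~ y) (df x y)) ->
  (forall x y, u < x -> x < v -> A y -> `|df x y| <= C) ->
  is_derive a 1 (fun x => \int[mu]_(y in A) f x y) (\int[mu]_(y in A) df a y).
Proof.
move=> ua av mf fC fdf dfC.
have d1 x y : u < x -> x < v -> A y -> partial1of2 f x y = df x y.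
  by move=> ux xv Ay; rewrite partial1of2E; have [_] := fdf x y ux xv Ay.
have Ia : `]u, v[%classic a by rewrite /= in_itv/= ua av.
have intf x : `]u, v[%classic x -> mu.-integrable A (EFin \o f x).
  rewrite /= in_itv/= => /andP[ux xv]; apply: (@bounded_integrable _ C) => //.
  by move=> y; exact: fC.
have derf x y : `]u, v[%classic x -> A y -> derivable (f ^~ y) x 1.
  by rewrite /= in_itv/= => /andP[ux xv] Ay; have [] := fdf x y ux xv Ay.
(* Constants are integrable for a probability, so [|C|] can dominate; the absolute value is there
   because [A] may be empty and C negative. *)
have G0 (y : T) : 0 <= cst `|C| y by exact: normr_ge0.
have intG : mu.-integrable A (EFin \o (cst `|C| : T -> R)).
  by apply: (@bounded_integrable _ `|C|) => // y _ /=; rewrite normr_id.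
have Gub x y : `]u, v[%classic x -> A y -> `|partial1of2 f x y| <= cst `|C| y.
  rewrite /= in_itv/= => /andP[ux xv] Ay; rewrite d1//.
  exact: le_trans (dfC _ _ ux xv Ay) (ler_norm _).
apply: DeriveDef.
  exact: (derivable_under_integral mA Ia intf derf G0 intG Gub).
rewrite -derive1E (differentiation_under_integral mA Ia intf derf G0 intG Gub).
by apply: eq_Rintegral => y; rewrite inE => Ay; rewrite -d1.
Qed.

End IntegralCalculus.

(** * Regularised moments and their derivatives *)

Lemma le0_ler_powR (R : realType) (c x g : R) :
  0 < c -> c <= x -> g <= 0 -> x `^ g <= c `^ g.
Proof.
move=> c0 cx g0; have x0 : 0 < x by exact: lt_le_trans cx.
rewrite -(opprK g) !(powRN _ (- g)) lef_pV2 ?posrE ?powR_gt0//.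
by rewrite ge0_ler_powR ?nnegrE ?oppr_ge0// ltW.
Qed.

Section Moments.
Context {R : realType} {n : nat}.
Implicit Types (e s g : R) (k : nat) (y : 'rV[R]_n.+1).

(* [sqdist e s y] is |s e_1 - y|^2 + e. *)
Definition sqdist e s y : R :=
  (s - y 0 0) ^+ 2 + (enorm y ^+ 2 - y 0 0 ^+ 2) + e.

Lemma sqdist0E s y : sqdist 0 s y = enorm (s *: delta_mx 0 0 - y) ^+ 2.
Proof.
rewrite /sqdist !sqr_enorm !big_ord_recl/= addr0 addrAC subrr add0r !mxE/= mulr1.
congr +%R; apply: eq_bigr => i _; rewrite !mxE/=.
by rewrite mulr0 sub0r sqrrN.
Qed.

Lemma sqr_coord_le_enorm y i : y 0 i ^+ 2 <= enorm y ^+ 2.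
Proof.
by rewrite -real_normK ?num_real// lerXn2r ?nnegrE ?enorm_ge0// coord_le_enorm.
Qed.

Lemma sqdist_ge e s y : e <= sqdist e s y.
Proof. by rewrite lerDr addr_ge0 ?sqr_ge0// subr_ge0 sqr_coord_le_enorm. Qed.

(** The gap is 2 s (|y| - y_1). The bound keeps D away from 0, even for e = 0, when s exceeds all
    radii of the shell. *)
Lemma sqdist_ge_sub e s y : 0 <= s -> (s - enorm y) ^+ 2 + e <= sqdist e s y.
Proof.
move=> s0; rewrite lerD2r -subr_ge0.
rewrite (_ : _ - _ = 2 * (s * (enorm y - y 0 0))); last by ring.
by rewrite !mulr_ge0// subr_ge0 (le_trans (ler_norm _))// coord_le_enorm.
Qed.

Lemma measurable_sqdist e s :
  measurable_fun [set: Rd R n.+1] (sqdist e s : Rd R n.+1 -> R).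
Proof.
have m0 := @measurable_coord R n.+1 0; have me := @measurable_enorm R n.+1.
apply: measurable_funD => //; apply: measurable_funD.
  by apply: measurable_funX; exact: measurable_funB.
by apply: measurable_funB; exact: measurable_funX.
Qed.

Lemma measurable_sqdist_powR e s g k :
  measurable_fun [set: Rd R n.+1]
    (fun y : Rd R n.+1 => sqdist e s y `^ g * (s - (y : 'rV[R]_n.+1) 0 0) ^+ k).
Proof.
have m0 := @measurable_coord R n.+1 0.
apply: measurable_funM.
  apply: (@measurableT_comp _ _ _ _ _ _ (@powR R ^~ g)) => //.
  exact: measurable_sqdist.
by apply: measurable_funX; exact: measurable_funB.
Qed.

Lemma is_derive_sqdist e s y :
  is_derive s 1 (sqdist e ^~ y) (2 * (s - y 0 0)).
Proof.
rewrite (_ : sqdist e ^~ y = (id - cst (y 0 0)) ^+ 2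
   + cst (enorm y ^+ 2 - y 0 0 ^+ 2 + e)); last first.
  by apply/funext => t; rewrite /sqdist -addrA; reflexivity.
apply: is_derive_eq.
rewrite /= subr0 addr0 /GRing.scale/= mulr1; congr (_ * _).
Qed.

Context (mu : probability (Rd R n.+1) R) (mur : radially_symmetric mu).
Variables (I : set R) (M : R).
Hypotheses (mI : measurable I) (IM : forall r, I r -> r <= M).

Definition shell : set (Rd R n.+1) := enorm @^-1` I.

Lemma measurable_shell : measurable shell.
Proof. by rewrite -[shell]setTI; exact: measurable_enorm. Qed.

(** The values k = 0 and k = 1 give m_g and n_g; k = 2 arises on differentiating n_g and is
    eliminated by [moment_rotation]. *)
Definition moment e g k s :=
  \int[mu]_(y in shell) (sqdist e s y `^ g * (s - (y : 'rV[R]_n.+1) 0 0) ^+ k).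

Lemma integrable_moment e g k s c : 0 < c -> g <= 0 ->
  (forall y, shell y -> c <= sqdist e s y) ->
  mu.-integrable shell (EFin \o
    (fun y : Rd R n.+1 => sqdist e s y `^ g * (s - (y : 'rV[R]_n.+1) 0 0) ^+ k)).
Proof.
move=> c0 g0 cD; apply: (@bounded_integrable _ _ _ _ _ _ _ (c `^ g * (`|s| + `|M|) ^+ k)).
- exact: measurable_shell.
- exact: measurable_sqdist_powR.
- move=> y Ay; rewrite normrM normrX ger0_norm ?powR_ge0//.
  rewrite ler_pM ?powR_ge0 ?exprn_ge0// ?le0_ler_powR ?cD//.
  rewrite lerXn2r ?nnegrE ?addr_ge0// (le_trans (ler_normB _ _))// lerD2l.
  by rewrite (le_trans (coord_le_enorm _ _))// (le_trans (IM _ Ay))// ler_norm.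
Qed.

(** At k = 0 the index [k.-1] is 0, which is harmless since its coefficient vanishes. *)
Lemma is_derive_moment e g k s u v c : 0 < c -> g <= 0 -> u < s -> s < v ->
  (forall x y, u < x -> x < v -> shell y -> c <= sqdist e x y) ->
  is_derive s 1 (moment e g k)
    (2 * g * moment e (g - 1) k.+1 s + k%:R * moment e g k.-1 s).
Proof.
move=> c0 g0 us sv cD.
(* B bounds |x - y_1| for x in ]u, v[ and y in the shell; below, C1 bounds the integrand and C2 its
   derivative. *)
pose B := `|u| + `|v| + `|M|.
have B0 : 0 <= B by rewrite !addr_ge0.
have xB x y : u < x -> x < v -> shell y -> `|x - y 0 0| <= B.
  move=> ux xv Ay; rewrite (le_trans (ler_normB _ _))// lerD//.
    rewrite ler_norml; move: (ler_norm v) (ler_norm (- u)) (normr_ge0 u) (normr_ge0 v).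
    by rewrite normrN => *; apply/andP; split; lra.
  by rewrite (le_trans (coord_le_enorm _ _))// (le_trans (IM _ Ay))// ler_norm.
have bnd h l x y : h <= 0 -> u < x -> x < v -> shell y ->
    `|sqdist e x y `^ h * (x - y 0 0) ^+ l| <= c `^ h * B ^+ l.
  move=> h0 ux xv Ay; rewrite normrM normrX ger0_norm ?powR_ge0//.
  by rewrite ler_pM ?powR_ge0 ?exprn_ge0// ?le0_ler_powR ?cD// lerXn2r ?nnegrE// xB.
pose C1 := c `^ g * B ^+ k.
pose C2 := `|2 * g| * (c `^ (g - 1) * B ^+ k.+1) + k%:R * (c `^ g * B ^+ k.-1).
have C10 : 0 <= C1 by rewrite mulr_ge0 ?powR_ge0 ?exprn_ge0.
have C20 : 0 <= C2 by rewrite addr_ge0// !mulr_ge0 ?powR_ge0 ?exprn_ge0.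
have g1 : g - 1 <= 0 by lra.
pose f x (y : Rd R n.+1) := sqdist e x y `^ g * (x - (y : 'rV[R]_n.+1) 0 0) ^+ k.
pose df x (y : Rd R n.+1) :=
  2 * g * (sqdist e x y `^ (g - 1) * (x - (y : 'rV[R]_n.+1) 0 0) ^+ k.+1)
  + k%:R * (sqdist e x y `^ g * (x - (y : 'rV[R]_n.+1) 0 0) ^+ k.-1).
have int_s l h : h <= 0 -> mu.-integrable shell (EFin \o
    (fun y : Rd R n.+1 => sqdist e s y `^ h * (s - (y : 'rV[R]_n.+1) 0 0) ^+ l)).
  by move=> h0; apply: integrable_moment c0 h0 _ => y; exact: cD.
have mA := measurable_shell.
have -> : 2 * g * moment e (g - 1) k.+1 s + k%:R * moment e g k.-1 s =
    \int[mu]_(y in shell) df s y.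
  rewrite /df RintegralD//; last 2 first.
  - exact: (integrableZl mA (2 * g) (int_s k.+1 (g - 1) g1)).
  - exact: (integrableZl mA k%:R (int_s k.-1 g g0)).
  by rewrite !RintegralZl//; exact: int_s.
apply: (@is_derive_Rintegral _ _ _ mu shell mA f df s u v (C1 + C2) us sv).
- by move=> x; exact: measurable_sqdist_powR.
- by move=> x y ux xv Ay; rewrite (le_trans (bnd g k x y g0 ux xv Ay))// lerDl.
- move=> x y ux xv Ay.
  have D0 : 0 < sqdist e x y by rewrite (lt_le_trans c0)// cD.
  have H1 := @is_derive_powR _ (sqdist e ^~ y) x _ g D0 (is_derive_sqdist e x y).
  have H2 : is_derive x 1 ((id - cst (y 0 0)) ^+ k : R -> R) (k%:R * (x - y 0 0) ^+ k.-1).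
    by apply: is_derive_eq; rewrite /GRing.scale/= subr0 mulr1.
  rewrite (_ : f ^~ y = (fun t => sqdist e t y `^ g) * ((id - cst (y 0 0)) ^+ k)); last first.
    by apply/funext => t; rewrite /f [RHS]/= exprfctE.
  apply: (is_derive_eq (is_deriveM H1 H2)); rewrite exprfctE /df /GRing.scale/= exprS; ring.
- move=> x y ux xv Ay; rewrite /df (le_trans (ler_normD _ _))//.
  rewrite (le_trans (y := C2)) ?lerDr// lerD// normrM ler_pM// ?bnd//.
  by rewrite ger0_norm.
Qed.

End Moments.

(** * Infinitesimal rotation invariance of the moments *)

Lemma Rintegral_sum {R : realType} {d} {T : measurableType d}
    (mu : probability T R) (A : set T) {J : Type} (r : seq J) (F : J -> T -> R) :
  measurable A -> (forall j, mu.-integrable A (EFin \o F j)) ->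
  \int[mu]_(y in A) (\sum_(j <- r) F j y) = \sum_(j <- r) \int[mu]_(y in A) F j y.
Proof.
move=> mA iF; rewrite /Rintegral.
under eq_integral do rewrite -sumEFin.
rewrite integral_sum//.
elim: r => [|j r IHr]; first by rewrite !big_nil.
rewrite !big_cons fineD ?IHr//; first exact: integrable_fin_num (iF j).
rewrite -integral_sum//; apply: integrable_fin_num => //.
by apply: (integrable_sum mA r) => i _; exact: iF.
Qed.

Lemma is_derive_cos_sin {R : realType} (a b t : R) :
  is_derive t 1 (fun t => cos t * a + sin t * b) (- sin t * a + cos t * b).
Proof.
have ca := is_derive_cst a t (1 : R); have cb := is_derive_cst b t (1 : R).
have H := is_deriveD (is_deriveM (is_derive_cos t) ca) (is_deriveM (is_derive_sin t) cb).
by apply: (is_derive_eq H); rewrite /GRing.scale/=; ring.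
Qed.

Section Rotation.
Context {R : realType} {n : nat}.
Context (mu : probability (Rd R n.+1) R) (mur : radially_symmetric mu).
Variables (I : set R) (M : R).
Hypotheses (mI : measurable I) (IM : forall r, I r -> r <= M).
Implicit Types (e s g : R) (k : nat).
Local Notation mom := (moment mu I).
Local Notation shell := (@shell R n I).

(* The integral of y_j D^g is invariant under the rotations in the plane of
   e_1 and e_j; this is the vanishing of its derivative at angle 0. *)
Lemma plane_rot_identity e g s c (j : 'I_n.+1) : j != 0 -> 0 < c -> g <= 0 ->
  (forall y, shell y -> c <= sqdist e s y) ->
  \int[mu]_(y in shell) ((y : 'rV[R]_n.+1) 0 0 * sqdist e s y `^ g
     + 2 * s * g * ((y : 'rV[R]_n.+1) 0 j ^+ 2 * sqdist e s y `^ (g - 1))) = 0.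
Proof.
move=> j0 c0 g0 cD.
have j0' : 0 != j by rewrite eq_sym.
have mA := @measurable_shell _ n _ mI.
pose Q t := @plane_rot R n.+1 0 j t.
have QQ t : Q t *m (Q t)^T = 1%:M by exact: plane_rot_orthogonal.
have enQ t (y : 'rV[R]_n.+1) : enorm (y *m Q t) = enorm y by exact: enorm_mulmx.
have shQ t (y : Rd R n.+1) : shell ((y : 'rV[R]_n.+1) *m Q t) <-> shell y.
  by change (I (enorm ((y : 'rV[R]_n.+1) *m Q t)) <-> I (enorm y)); rewrite enQ.
(* X and Y are the coordinates 0 and j of the rotated point, D its regularised squared distance to s
   e_1. The norm being invariant, D depends on t through X only. *)
pose X t (y : Rd R n.+1) := cos t * (y : 'rV[R]_n.+1) 0 0 - sin t * (y : 'rV[R]_n.+1) 0 j.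
pose Y t (y : Rd R n.+1) := cos t * (y : 'rV[R]_n.+1) 0 j + sin t * (y : 'rV[R]_n.+1) 0 0.
pose D t (y : Rd R n.+1) := s ^+ 2 - 2 * s * X t y + enorm y ^+ 2 + e.
have XE t (y : Rd R n.+1) : X t y = ((y : 'rV[R]_n.+1) *m Q t) 0 0.
  by rewrite mulmx_plane_rotE// eqxx /X; ring.
have YE t (y : Rd R n.+1) : Y t y = ((y : 'rV[R]_n.+1) *m Q t) 0 j.
  by rewrite mulmx_plane_rotE// (negbTE j0) eqxx /Y; ring.
have DE t (y : Rd R n.+1) : D t y = sqdist e s ((y : 'rV[R]_n.+1) *m Q t).
  by rewrite /sqdist -XE enQ /D; ring.
have XM t (y : Rd R n.+1) : shell y -> `|X t y| <= `|M|.
  move=> Ay; rewrite XE (le_trans (coord_le_enorm _ _))// enQ.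
  by rewrite (le_trans (IM _ Ay))// ler_norm.
have YM t (y : Rd R n.+1) : shell y -> `|Y t y| <= `|M|.
  move=> Ay; rewrite YE (le_trans (coord_le_enorm _ _))// enQ.
  by rewrite (le_trans (IM _ Ay))// ler_norm.
have Dc t (y : Rd R n.+1) : shell y -> c <= D t y.
  by move=> Ay; rewrite DE cD//; apply/shQ.
have g1 : g - 1 <= 0 by lra.
have Dg h t (y : Rd R n.+1) : h <= 0 -> shell y -> D t y `^ h <= c `^ h.
  by move=> h0 Ay; rewrite le0_ler_powR// Dc.
have m0 := @measurable_coord R n.+1 0.
have mj := @measurable_coord R n.+1 j.
have mf : measurable_fun setT (fun y : Rd R n.+1 => (y : 'rV[R]_n.+1) 0 j * sqdist e s y `^ g).
  apply: measurable_funM => //.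
  apply: (@measurableT_comp _ _ _ _ _ _ (@powR R ^~ g)) => //.
  exact: measurable_sqdist.
pose f t (y : Rd R n.+1) := Y t y * D t y `^ g.
pose df t (y : Rd R n.+1) := X t y * D t y `^ g + Y t y * (g * D t y `^ (g - 1) * (2 * s * Y t y)).
have fE t : f t = (fun y : Rd R n.+1 => (y : 'rV[R]_n.+1) 0 j * sqdist e s y `^ g)
    \o (fun y : Rd R n.+1 => (y : 'rV[R]_n.+1) *m Q t : Rd R n.+1).
  by apply/funext => y; rewrite /f /= YE DE.
have mft t : measurable_fun setT (f t).
  rewrite fE; apply: measurableT_comp => //; exact: measurable_mulmx.
pose C1 := `|M| * c `^ g.
pose C2 := `|M| * (`|g| * c `^ (g - 1) * (`|2 * s| * `|M|)).
have C10 : 0 <= C1 by rewrite mulr_ge0 ?powR_ge0.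
have C20 : 0 <= C2 by rewrite !mulr_ge0 ?powR_ge0.
have fC t (y : Rd R n.+1) : shell y -> `|f t y| <= C1.
  by move=> Ay; rewrite normrM ler_pM ?YM// ger0_norm ?powR_ge0// Dg.
have d0 : is_derive (0 : R) 1 (fun t => \int[mu]_(y in shell) f t y) (\int[mu]_(y in shell) df 0 y).
  apply: (@is_derive_Rintegral _ _ _ mu shell mA f df 0 (-1) 1 (C1 + C2)) => //.
  - by move=> t y _ _ Ay; rewrite (le_trans (fC t y Ay))// lerDl.
  - move=> t y _ _ Ay.
    have D0 : 0 < D t y by rewrite (lt_le_trans c0)// Dc.
    have dX : is_derive t 1 (X ^~ y) (- Y t y).
      rewrite (_ : - Y t y = - sin t * (y : 'rV[R]_n.+1) 0 0 + cos t * - (y : 'rV[R]_n.+1) 0 j).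
        rewrite (_ : X ^~ y = fun t => cos t * (y : 'rV[R]_n.+1) 0 0 + sin t * - (y : 'rV[R]_n.+1) 0 j).
          exact: is_derive_cos_sin.
        by apply/funext => u; rewrite /X mulrN.
      by rewrite /Y; ring.
    have dY : is_derive t 1 (Y ^~ y) (X t y).
      rewrite (_ : X t y = - sin t * (y : 'rV[R]_n.+1) 0 j + cos t * (y : 'rV[R]_n.+1) 0 0).
        exact: is_derive_cos_sin.
      by rewrite /X; ring.
    have dD : is_derive t 1 (D ^~ y) (2 * s * Y t y).
      rewrite (_ : D ^~ y = cst (s ^+ 2) - cst (2 * s) * X ^~ y + cst (enorm y ^+ 2) + cst e)//.
      apply: is_derive_eq; rewrite /GRing.scale/=; ring.
    have dP := @is_derive_powR R (D ^~ y) t _ g D0 dD.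
    have dM := @is_deriveM _ _ (Y ^~ y) (fun t => D t y `^ g) t 1 _ _ dY dP.
    apply: (is_derive_eq dM).
    by rewrite /df /GRing.scale/=; ring.
  - move=> t y _ _ Ay; rewrite /df (le_trans (ler_normD _ _))// lerD//.
      by rewrite normrM ler_pM ?XM// ger0_norm ?powR_ge0// Dg.
    rewrite !normrM -/(`|M|) /C2 normrM (ger0_norm (powR_ge0 _ (g - 1))).
    by rewrite !ler_pM ?mulr_ge0 ?powR_ge0 ?YM ?Dg.
(* The rotation preserves both [mu] and the shell, so the integral does not depend on t and its
   derivative at 0 vanishes. *)
have fcst : (fun t => \int[mu]_(y in shell) f t y) =
    cst (\int[mu]_(y in shell) ((y : 'rV[R]_n.+1) 0 j * sqdist e s y `^ g)).
  apply/funext => t /=; rewrite fE.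
  apply: (Rintegral_mulmx mu mur (Q t) shell (fun y : Rd R n.+1 =>
    (y : 'rV[R]_n.+1) 0 j * sqdist e s y `^ g) (QQ t) mA (shQ t)) => //.
  rewrite (_ : (fun y : Rd R n.+1 => _) = f t); last by rewrite fE.
  by apply: (@bounded_integrable _ _ _ _ _ mA _ C1 (mft t)); exact: fC.
have [_] := d0; rewrite fcst derive_cst => /esym <-.
apply: eq_Rintegral => y _; rewrite /df.
have -> : X 0 y = (y : 'rV[R]_n.+1) 0 0 by rewrite /X cos0 sin0; ring.
have -> : Y 0 y = (y : 'rV[R]_n.+1) 0 j by rewrite /Y cos0 sin0; ring.
have -> : D 0 y = sqdist e s y.
  by rewrite /D /X cos0 sin0 /sqdist; ring.
by ring.
Qed.

(** Sum of [plane_rot_identity] over the n indices j <> 0, where the y_j^2 add up to D - (s - y_1)^2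
    - e. It ties the second moment to m and n, which closes the system. *)
Lemma moment_rotation e g s c : 0 < c -> g <= 0 ->
  (forall y, shell y -> c <= sqdist e s y) ->
  n%:R * (s * mom e g 0 s - mom e g 1 s) +
  2 * s * g * (mom e g 0 s - e * mom e (g - 1) 0 s - mom e (g - 1) 2 s) = 0.
Proof.
move=> c0 g0 cD.
have mA := @measurable_shell _ n _ mI.
have g1 : g - 1 <= 0 by lra.
have int_s l h : h <= 0 -> mu.-integrable shell (EFin \o
    (fun y : Rd R n.+1 => sqdist e s y `^ h * (s - (y : 'rV[R]_n.+1) 0 0) ^+ l)).
  by move=> h0; exact: (integrable_moment mu I M mI IM e h l s c c0 h0 cD).
pose F (i : 'I_n) (y : Rd R n.+1) := (y : 'rV[R]_n.+1) 0 0 * sqdist e s y `^ g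
     + 2 * s * g * ((y : 'rV[R]_n.+1) 0 (lift 0 i) ^+ 2 * sqdist e s y `^ (g - 1)).
have F0 i : \int[mu]_(y in shell) F i y = 0.
  by apply: (@plane_rot_identity _ _ _ c) => //.
have iF i : mu.-integrable shell (EFin \o F i).
  pose C := `|M| * c `^ g + `|2 * s * g| * (`|M| ^+ 2 * c `^ (g - 1)).
  apply: (@bounded_integrable _ _ _ _ _ mA _ C).
    have m0 := @measurable_coord R n.+1 0.
    have mj := @measurable_coord R n.+1 (lift 0 i).
    have mP h : measurable_fun setT (fun y : Rd R n.+1 => sqdist e s y `^ h).
      apply: (@measurableT_comp _ _ _ _ _ _ (@powR R ^~ h)) => //.
      exact: measurable_sqdist.
    apply: measurable_funD; first exact: measurable_funM.
    apply: measurable_funM => //; apply: measurable_funM => //.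
    exact: measurable_funX.
  move=> y Ay; rewrite /F (le_trans (ler_normD _ _))// lerD//.
    rewrite normrM ler_pM// ?(ger0_norm (powR_ge0 _ _)) ?le0_ler_powR ?cD//.
    rewrite (le_trans (coord_le_enorm _ _))// (le_trans (IM _ Ay))//.
    exact: ler_norm.
  rewrite normrM ler_wpM2l// normrM normrX ler_pM ?exprn_ge0//.
    rewrite lerXn2r ?nnegrE// (le_trans (coord_le_enorm _ _))//.
    by rewrite (le_trans (IM _ Ay))// ler_norm.
  by rewrite ger0_norm ?powR_ge0// le0_ler_powR// cD.
have := @Rintegral_sum _ _ _ mu shell _ (index_enum 'I_n) F mA iF.
rewrite big1 => [<-|i _]; last exact: F0.
pose G l h (y : Rd R n.+1) := sqdist e s y `^ h * (s - (y : 'rV[R]_n.+1) 0 0) ^+ l.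
have iZ (k : R) l h : h <= 0 -> mu.-integrable shell (EFin \o (fun y => k * G l h y)).
  by move=> h0; exact: (integrableZl mA k (int_s l h h0)).
have iD (f1 f2 : Rd R n.+1 -> R) : mu.-integrable shell (EFin \o f1) ->
    mu.-integrable shell (EFin \o f2) ->
    mu.-integrable shell (EFin \o (fun y => f1 y + f2 y)).
  by move=> i1 i2; exact: (integrableD mA i1 i2).
transitivity (\int[mu]_(y in shell) ((n%:R * s + 2 * s * g) * G 0 g y +
   (- n%:R * G 1 g y + (- (2 * s * g * e) * G 0 (g - 1) y +
   - (2 * s * g) * G 2 (g - 1) y)))).
  have i1 := iZ (n%:R * s + 2 * s * g) 0%N _ g0.
  have i2 := iZ (- n%:R) 1%N _ g0.
  have i3 := iZ (- (2 * s * g * e)) 0%N _ g1.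
  have i4 := iZ (- (2 * s * g)) 2%N _ g1.
  have i34 := iD _ _ i3 i4; have i234 := iD _ _ i2 i34.
  rewrite !RintegralD//.
  rewrite !RintegralZl//; try exact: int_s.
  rewrite /moment/=; ring.
apply: eq_Rintegral => y; rewrite inE => Ay.
rewrite /F big_split/= sumr_const card_ord -mulr_sumr -mulr_suml.
have D0 : 0 < sqdist e s y by rewrite (lt_le_trans c0)// cD.
rewrite /G.
have -> : sqdist e s y `^ g = sqdist e s y * sqdist e s y `^ (g - 1).
  rewrite -{2}(powRr1 (ltW D0)) -powRD ?(gt_eqF D0) ?implybT//.
  by congr (_ `^ _); ring.
have -> : \sum_(i < n) (y : 'rV[R]_n.+1) 0 (lift 0 i) ^+ 2 = enorm y ^+ 2 - (y : 'rV[R]_n.+1) 0 0 ^+ 2.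
  by rewrite sqr_enorm big_ord_recl addrC addKr.
have -> : enorm y ^+ 2 - (y : 'rV[R]_n.+1) 0 0 ^+ 2
    = sqdist e s y - (s - (y : 'rV[R]_n.+1) 0 0) ^+ 2 - e.
  by rewrite /sqdist; ring.
by ring.
Qed.

End Rotation.

(** * Differential system for the moments *)

Section Ode.
Context {R : realType} {k : nat}.
Local Notation n := k.+1.
Context (mu : probability (Rd R n.+1) R) (mur : radially_symmetric mu).
Variables (I : set R) (M : R).
Hypotheses (mI : measurable I) (IM : forall r, I r -> r <= M).
Implicit Types (s g : R).
Variables (e lo : R).
(** Covers two situations: e > 0 with lo = -1 and c = e, and e = 0 with lo = M, beyond a shell
    contained in the ball of radius M. *)
Hypothesis sqdist_bound : forall s, lo < s -> exists2 c, 0 < c &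
  forall x (y : 'rV[R]_n.+1), s <= x -> I (enorm y) -> c <= sqdist e x y.
Local Notation m g := (moment mu I e g 0).
Local Notation nn g := (moment mu I e g 1).

Let is_derive_momentW g j s : g <= 0 -> lo < s ->
  is_derive s 1 (moment mu I e g j)
    (2 * g * moment mu I e (g - 1) j.+1 s + j%:R * moment mu I e g j.-1 s).
Proof.
move=> g0 los; have [c c0 cD] := sqdist_bound ((lo + s) / 2) ltac:(lra).
apply: (@is_derive_moment _ _ mu I M mI IM e g j s ((lo + s) / 2) (s + 1) c) => //.
- by lra.
- by lra.
- by move=> x y ux _ Ay; apply: cD => //; exact: ltW.
Qed.

Lemma is_derive_moment0 g s : g <= 0 -> lo < s ->
  is_derive s 1 (m g) (2 * g * nn (g - 1) s).
Proof.
move=> g0 los; apply: (is_derive_eq (is_derive_momentW g 0 s g0 los)).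
by rewrite mul0r addr0.
Qed.

(* The integral of div (z (|z|^2 + e)^g) at z = s e_1 - y, i.e. of the
   Laplacian of the regularised potential when g = (alpha - 2) / 2. *)
Definition laplacian_moment g s : R :=
  (n.+1%:R + 2 * g) * m g s - 2 * g * e * m (g - 1) s.

(** The product rule leaves a second moment of exponent g - 1; the two sides then differ by - s^k
    times the left side of [moment_rotation], which is 0. *)
Lemma is_derive_flux g s : g <= 0 -> lo < s ->
  is_derive s 1 (fun t => t ^+ n * nn g t) (s ^+ n * laplacian_moment g s).
Proof.
move=> g0 los; have [c c0 cD] := sqdist_bound s los.
have rot := moment_rotation mu mur I M mI IM e g s c c0 g0 (fun y => cD s y (lexx s)).
apply: (is_derive_eq (is_derive_exprnM n s _ _ (is_derive_momentW g 1 s g0 los))).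
rewrite /laplacian_moment mul1r.
apply/eqP; rewrite -subr_eq0; apply/eqP.
transitivity (- s ^+ k * (n%:R * (s * m g s - nn g s) +
    2 * s * g * (m g s - e * m (g - 1) s - moment mu I e (g - 1) 2 s))).
  rewrite -(natr1 n) [s ^+ n]exprS -[n.-1]/k -[1.-1]/0%N.
  move: (m g s) (nn g s) (m (g - 1) s) (moment _ _ _ _ _ s) => A B C D.
  by ring.
by rewrite rot mulr0.
Qed.

Lemma moment0_ge0 g s : 0 <= m g s.
Proof. by apply: Rintegral_ge0 => y _; rewrite expr0 mulr1 powR_ge0. Qed.

(** * Monotonicity of the averaged Laplacian and of its averages *)

Section Superharmonic.
Variable b : R.
(** The dimension is d = k + 2, so [bk] reads d + 2 b >= 2. With lo < 0 the differential system
    holds down to s = 0. *)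
Hypotheses (b0 : b < 0) (bk : 0 <= k%:R + 2 * b) (e0 : 0 <= e) (lo0 : lo < 0).
Local Notation u := (laplacian_moment b).

Lemma is_derive_laplacian_moment s : lo < s ->
  is_derive s 1 u (2 * b * ((n.+1%:R + 2 * b) * nn (b - 1) s
                            - 2 * (b - 1) * e * nn (b - 1 - 1) s)).
Proof.
move=> los; have b1 : b - 1 <= 0 by rewrite subr_le0 (le_trans (ltW b0)).
have H1 := is_derive_moment0 b s (ltW b0) los.
have H2 := is_derive_moment0 (b - 1) s b1 los.
apply: (is_derive_eq (is_derive_lincomb (n.+1%:R + 2 * b) (2 * b * e) _ _ _ _ _ H1 H2)).
move: (nn (b - 1) s) (nn (b - 1 - 1) s) => C D.
by ring.
Qed.

(* Times s^n, the left side vanishes at 0 and has a nonnegative derivative: this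
   is the superharmonicity of the Laplacian of the potential, b being negative. *)
Lemma laplacian_moment_flux_ge0 s : 0 < s ->
  0 <= (n.+1%:R + 2 * b) * nn (b - 1) s - 2 * (b - 1) * e * nn (b - 1 - 1) s.
Proof.
move=> s0; have b1 : b - 1 <= 0 by rewrite subr_le0 (le_trans (ltW b0)).
have b2 : b - 1 - 1 <= 0 by rewrite subr_le0 (le_trans b1).
pose W t := (n.+1%:R + 2 * b) * (t ^+ n * nn (b - 1) t)
          - 2 * (b - 1) * e * (t ^+ n * nn (b - 1 - 1) t).
suff : 0 <= W s.
  rewrite (_ : W s = s ^+ n * ((n.+1%:R + 2 * b) * nn (b - 1) s
     - 2 * (b - 1) * e * nn (b - 1 - 1) s)); last first.
    rewrite /W; move: (nn (b - 1) s) (nn (b - 1 - 1) s) (s ^+ n) => A B C.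
    by ring.
  by rewrite pmulr_rge0// exprn_gt0.
have W0 : W 0 = 0 by rewrite /W expr0n/= !mul0r !mulr0 subr0.
rewrite -W0.
pose dW t := (n.+1%:R + 2 * b) * (t ^+ n * laplacian_moment (b - 1) t)
          - 2 * (b - 1) * e * (t ^+ n * laplacian_moment (b - 1 - 1) t).
apply: (@is_derive_ge0_le _ 0 s W dW (ltW s0)) => t.
  move=> t0 _; have lot : lo < t by exact: lt_le_trans t0.
  have H1 := is_derive_flux (b - 1) t b1 lot.
  have H2 := is_derive_flux (b - 1 - 1) t b2 lot.
  exact: is_derive_lincomb.
move=> t0 _.
have [hb hk he] : [/\ b < 0, 0 <= k%:R + 2 * b & 0 <= e] by [].
have h1 : 0 <= k%:R + 2 + 2 * b by rewrite addrAC addr_ge0.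
have h2 : 0 <= 1 - b by rewrite subr_ge0 (le_trans (ltW hb)).
have h3 : 0 <= 2 - b by rewrite subr_ge0 (le_trans (ltW hb)).
have m1 := moment0_ge0 (b - 1) t; have m2 := moment0_ge0 (b - 1 - 1) t.
have m3 := moment0_ge0 (b - 1 - 1 - 1) t.
(* The two contributions to m_(b-2) carry d + 2 b and d + 2 b - 4, adding up to 2 (d + 2 b - 2).
   Thus d + 2 b >= 2 makes all three coefficients nonnegative. *)
rewrite (_ : dW t = t ^+ n * ((k%:R + 2 + 2 * b) * (k%:R + 2 * b) * m (b - 1) t
   + 4 * (1 - b) * (k%:R + 2 * b) * e * m (b - 1 - 1) t
   + 4 * (1 - b) * (2 - b) * e ^+ 2 * m (b - 1 - 1 - 1) t)); last first.
  rewrite /dW /laplacian_moment -(natr1 n) -(natr1 k).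
  move: (m (b - 1) t) (m (b - 1 - 1) t) (m (b - 1 - 1 - 1) t) (t ^+ n) => A B C X.
  by ring.
apply: mulr_ge0; first by rewrite exprn_ge0// ltW.
have he2 : 0 <= e ^+ 2 by rewrite exprn_ge0.
move: (m _ t) (m _ t) (m _ t) m1 m2 m3 => A B C A0 B0 C0.
by rewrite !addr_ge0// !mulr_ge0.
Qed.

Lemma laplacian_moment_le s t : 0 < s -> s <= t -> u t <= u s.
Proof.
move=> s0 st; rewrite -lerN2.
pose du x := - (2 * b * ((n.+1%:R + 2 * b) * nn (b - 1) x
                            - 2 * (b - 1) * e * nn (b - 1 - 1) x)).
apply: (@is_derive_ge0_le _ s t (fun x => - u x) du st) => x sx _.
  have lox : lo < x by rewrite (lt_trans lo0)// (lt_le_trans s0).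
  exact: is_deriveN (is_derive_laplacian_moment x lox).
rewrite /du -mulNr mulr_ge0//; first by rewrite -mulrN mulr_ge0// oppr_ge0 ltW.
by apply: laplacian_moment_flux_ge0; exact: lt_trans sx.
Qed.

(** Subtracting the primitive of c t^n reduces the comparison of u with the constant c to the sign
    of a derivative. *)
Lemma is_derive_sub_power c s : lo < s ->
  is_derive s 1 (fun t => t ^+ n * nn b t - c / n.+1%:R * t ^+ n.+1)
    (s ^+ n * (u s - c)).
Proof.
move=> los.
have H := is_derive_lincomb 1 (c / n.+1%:R) _ _ _ _ _ (is_derive_flux b s (ltW b0) los)
  (is_derive_exprn n.+1 s).
rewrite (_ : (fun t => t ^+ n * nn b t - _) =
  (fun t => 1 * (t ^+ n * nn b t) - c / n.+1%:R * t ^+ n.+1)); last first.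
  by apply/funext => t; rewrite mul1r.
apply: (is_derive_eq H); move: (u s) => v.
by rewrite [c / _ * _]mulrA divfK ?pnatr_eq0//= mul1r [c * _]mulrC -mulrBr.
Qed.

(* s^n nn(s) is the integral of t^n u(t) over [0, s], so nn(s) / s is, up to a
   constant, the average of the nonincreasing u with weight t^n. *)
Lemma moment1_div_le s t : 0 < s -> s <= t -> nn b t * s <= nn b s * t.
Proof.
move=> s0 st; have t0 : 0 < t by exact: lt_le_trans st.
have N0 : 0 < n.+1%:R :> R by rewrite ltr0n.
pose P c x := x ^+ n * nn b x - c / n.+1%:R * x ^+ n.+1.
(* Since u is nonincreasing, P with c = u(s) increases on [0, s], starting from 0, and decreases on
   [s, t]. *)
have h1 : 0 <= P (u s) s.
  rewrite (_ : 0 = P (u s) 0); last by rewrite /P !expr0n/= mul0r mulr0 subr0.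
  apply: (@is_derive_ge0_le _ 0 s (P (u s)) (fun x => x ^+ n * (u x - u s)) (ltW s0)).
    by move=> x x0 _; apply: is_derive_sub_power; exact: lt_le_trans x0.
  by move=> x x0 xs; rewrite mulr_ge0 ?exprn_ge0 ?(ltW x0)// subr_ge0 laplacian_moment_le// ltW.
have h2 : P (u s) t <= P (u s) s.
  rewrite -lerN2.
  apply: (@is_derive_ge0_le _ s t (fun x => - P (u s) x) (fun x => - (x ^+ n * (u x - u s))) st).
    move=> x sx _; apply: is_deriveN; apply: is_derive_sub_power.
    by rewrite (lt_trans lo0)// (lt_le_trans s0).
  move=> x sx _; rewrite -mulrN opprB mulr_ge0 ?exprn_ge0 ?(ltW (lt_trans s0 sx))//.
  by rewrite subr_ge0 laplacian_moment_le// ltW.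
move: h1 h2; rewrite /P; set v := u s / _ => h1 h2.
have ts : s ^+ n.+1 <= t ^+ n.+1 by rewrite lerXn2r ?nnegrE ?(ltW s0) ?(ltW t0).
(* The terms in v cancel, and P(s) (t^(n+1) - s^(n+1)) + (P(s) - P(t)) s^(n+1) remains. Division by
   s^n t^n then gives the claim. *)
have h : t ^+ n * nn b t * s ^+ n.+1 <= s ^+ n * nn b s * t ^+ n.+1.
  rewrite -subr_ge0.
  rewrite (_ : _ - _ = (s ^+ n * nn b s - v * s ^+ n.+1) * (t ^+ n.+1 - s ^+ n.+1)
   + ((s ^+ n * nn b s - v * s ^+ n.+1) - (t ^+ n * nn b t - v * t ^+ n.+1)) * s ^+ n.+1);
   last by ring.
  by apply: addr_ge0; apply: mulr_ge0 => //; rewrite ?subr_ge0// exprn_ge0// ltW.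
have st0 : 0 < s ^+ n * t ^+ n by rewrite mulr_gt0 ?exprn_gt0.
rewrite -(ler_pM2l st0); move: h; move: (nn b t) (nn b s) => A B.
by rewrite !(exprS _ n) => h; apply: le_trans (le_trans _ h) _;
  rewrite le_eqVlt; apply/orP; left; apply/eqP; ring.
Qed.

End Superharmonic.
End Ode.

(** * Passage to the singular kernel, and strictness *)

Section Singular.
Context {R : realType} {k : nat}.
Local Notation n := k.+1.
Context (mu : probability (Rd R n.+1) R) (mur : radially_symmetric mu).
Variable (I : set R).
Hypothesis mI : measurable I.
Implicit Types (s t b M : R).

Lemma sqdistD e s (y : 'rV[R]_n.+1) : sqdist e s y = sqdist 0 s y + e.
Proof. by rewrite /sqdist addr0. Qed.

Definition moment_integrable b s := mu.-integrable (shell I) (EFin \o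
  (fun y : Rd R n.+1 => sqdist 0 s y `^ b * (s - (y : 'rV[R]_n.+1) 0 0) ^+ 1)).

(** Dominated convergence with the singular integrand itself as bound: b < 0 gives (D + e)^b <= D^b
    where D > 0. Where D = 0 the factor s - y_1 vanishes too, so the value of [powR] at 0 does not
    matter. *)
Lemma moment_cvg b s : b < 0 -> moment_integrable b s ->
  moment mu I j.+1%:R^-1 b 1 s @[j --> \oo] --> moment mu I 0 b 1 s.
Proof.
move=> b0 intf; have mA := @measurable_shell R n I mI.
pose f e (y : Rd R n.+1) := sqdist e s y `^ b * (s - (y : 'rV[R]_n.+1) 0 0) ^+ 1.
have D0 (y : 'rV[R]_n.+1) : 0 <= sqdist 0 s y by exact: sqdist_ge.
have Dsub (y : 'rV[R]_n.+1) : sqdist 0 s y = 0 -> (s - y 0 0) ^+ 1 = 0.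
  move=> D00; apply/eqP; rewrite expr1 -sqrf_eq0 eq_le sqr_ge0 andbT -D00.
  by rewrite /sqdist addr0 lerDl subr_ge0 sqr_coord_le_enorm.
have H : (\int[mu]_(y in shell I) (f j.+1%:R^-1 y)%:E)%E @[j --> \oo] -->
    (\int[mu]_(y in shell I) (f 0 y)%:E)%E.
  apply: (@dominated_cvg _ _ _ mu (shell I) mA (fun j y => (f j.+1%:R^-1 y)%:E)
    (fun y => (f 0 y)%:E) (abse \o (EFin \o f 0))).
  - move=> j; apply/measurable_EFinP; apply: measurable_funTS.
    exact: measurable_sqdist_powR.
  - move=> y _; apply: cvg_EFin; first exact: nearW.
    have [D00|Dn0] := eqVneq (sqdist 0 s y) 0.
      rewrite (_ : _ \o _ = cst (f 0 y)); first exact: cvg_cst.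
      by apply/funext => j; rewrite /f /= Dsub// !mulr0.
    rewrite (_ : _ \o _ = fun j => sqdist j.+1%:R^-1 s y `^ b * (s - (y : 'rV[R]_n.+1) 0 0) ^+ 1)//.
    apply: cvgMr_tmp.
    have Dp : 0 < sqdist 0 s y by rewrite lt_def Dn0 D0.
    have cD : sqdist j.+1%:R^-1 s y @[j --> \oo] --> sqdist 0 s y.
      rewrite (_ : (fun j => _) = cst (sqdist 0 s y) + @harmonic R); last first.
        by apply/funext => j; rewrite sqdistD.
      rewrite -[X in _ --> X]addr0.
      by apply: cvgD; [exact: cvg_cst|exact: cvg_harmonic].
    apply: (@continuous_cvg _ _ _ _ _ (fun j => sqdist j.+1%:R^-1 s y) (@powR R ^~ b) _ _ cD).
    apply: differentiable_continuous; apply/derivable1_diffP.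
    by apply: derivable_powR; rewrite in_itv/= Dp.
  - by [].
  - exact: integrable_abse.
  - move=> j y _; rewrite /= lee_fin !normrM.
    have [D00|Dn0] := eqVneq (sqdist 0 s y) 0; first by rewrite Dsub// normr0 !mulr0.
    have Dp : 0 < sqdist 0 s y by rewrite lt_def Dn0 D0.
    rewrite ler_wpM2r// !ger0_norm ?powR_ge0// le0_ler_powR ?(ltW b0)//.
    by rewrite (sqdistD j.+1%:R^-1) lerDl invr_ge0.
rewrite /moment /Rintegral.
apply: fine_cvg; rewrite fineK; first exact: H.
exact: integrable_fin_num intf.
Qed.

Section Bounded.
Variables (b M : R).
Hypothesis (b0 : b < 0).
Hypothesis bk : 0 <= k%:R + 2 * b.
Hypothesis IM : forall r, I r -> r <= M.

(** Limit of [moment1_div_le] along e = 1 / (j + 1). Here s and t may be radii of the shell, so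
    integrability has to be assumed. *)
Lemma moment1_div_le0 s t : 0 < s -> s <= t ->
  moment_integrable b s -> moment_integrable b t ->
  moment mu I 0 b 1 t * s <= moment mu I 0 b 1 s * t.
Proof.
move=> s0 st is_ it.
have cs : moment mu I j.+1%:R^-1 b 1 s * t @[j --> \oo] --> moment mu I 0 b 1 s * t.
  by apply: cvgMr_tmp; exact: moment_cvg.
have ct : moment mu I j.+1%:R^-1 b 1 t * s @[j --> \oo] --> moment mu I 0 b 1 t * s.
  by apply: cvgMr_tmp; exact: moment_cvg.
apply: (ler_cvg_to ct cs); apply: nearW => j /=.
have e0 : 0 < j.+1%:R^-1 :> R by rewrite invr_gt0 ltr0n.
apply: (@moment1_div_le _ k mu mur I M mI IM j.+1%:R^-1 (-1)) => //.
- by move=> x _; exists j.+1%:R^-1 => // z y _ _; exact: sqdist_ge.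
Qed.

Hypotheses (M0 : 0 < M) (muI : (0 < mu (shell I))%E).

Let sqdist_bound s : M < s -> exists2 c, 0 < c &
  forall x (y : 'rV[R]_n.+1), s <= x -> I (enorm y) -> c <= sqdist 0 x y.
Proof.
move=> Ms; exists ((s - M) ^+ 2); first by rewrite exprn_gt0// subr_gt0.
move=> x y sx Iy; have yM := IM _ Iy.
apply: le_trans (@sqdist_ge_sub _ _ 0 x y _).
  by rewrite addr0 lerXn2r ?nnegrE ?subr_ge0//; lra.
by rewrite (le_trans (ltW M0))// (le_trans (ltW Ms)).
Qed.

Lemma moment_integrable_gt s : M < s -> moment_integrable b s.
Proof.
move=> Ms; have [c c0 cD] := sqdist_bound s Ms.
by apply: (integrable_moment mu I M mI IM 0 b 1 s c) => //; [exact: ltW|move=> y; exact: cD].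
Qed.

Lemma moment1_gt0 g s : g <= 0 -> M < s -> 0 < moment mu I 0 g 1 s.
Proof.
move=> g0 Ms; have mA := @measurable_shell R n I mI.
have [c c0 cD] := sqdist_bound s Ms.
(* On the shell |s e_1 - y| <= s + M and y_1 <= M, so for g <= 0 the integrand is at least C^g (s -
   M) > 0. *)
pose C := (s + M) ^+ 2.
have C0 : 0 < C `^ g * (s - M).
  by rewrite mulr_gt0 ?powR_gt0 ?exprn_gt0 ?subr_gt0 ?addr_gt0// (lt_trans M0).
have mu0 : 0 < fine (mu (shell I)).
  by rewrite fine_gt0// muI (le_lt_trans (probability_le1 mu mA))// ltry.
rewrite (lt_le_trans (mulr_gt0 C0 mu0))// -Rintegral_cst//.
apply: le_Rintegral => //.
- by apply: (@bounded_integrable _ _ _ _ _ mA _ `|C `^ g * (s - M)|).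
- exact: (integrable_moment mu I M mI IM 0 g 1 s c c0 g0 (fun y => cD s y (lexx s))).
- move=> y Iy; have Dp : 0 < sqdist 0 s y by rewrite (lt_le_trans c0)// cD.
  have yM : `|(y : 'rV[R]_n.+1) 0 0| <= M.
    by rewrite (le_trans (coord_le_enorm _ _))// IM.
  have := yM; rewrite ler_norml => /andP[y1 y2].
  have s0 := lt_trans M0 Ms.
  rewrite expr1 ler_pM ?powR_ge0 ?subr_ge0 ?(ltW Ms) ?lerB//.
  apply: le0_ler_powR => //; rewrite /sqdist addr0.
  have eM : enorm y ^+ 2 <= M ^+ 2.
    by rewrite lerXn2r ?nnegrE ?enorm_ge0 ?(ltW M0)// IM.
  rewrite (_ : _ + _ = s ^+ 2 - 2 * s * (y : 'rV[R]_n.+1) 0 0 + enorm y ^+ 2); last by ring.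
  rewrite (_ : C = s ^+ 2 + 2 * s * M + M ^+ 2); last by rewrite /C; ring.
  by rewrite lerD// lerD2l -mulrN ler_pM2l ?mulr_gt0// lerNl.
Qed.

(* Equality forces the radial Laplacian u to take the same value at two points
   beyond M, where u' is a negative multiple of the integral of D^(b-1) (s - y_1),
   whose integrand is positive. *)
Lemma moment1_div_lt s t : M < s -> s < t ->
  moment mu I 0 b 1 t * s < moment mu I 0 b 1 s * t.
Proof.
move=> Ms st; have s0 : 0 < s by exact: lt_trans Ms.
pose nn := moment mu I 0 b 1.
have le x y : s <= x -> x <= y -> nn y * x <= nn x * y.
  move=> sx xy; apply: moment1_div_le0 => //.
  - exact: lt_le_trans sx.
  - by apply: moment_integrable_gt; exact: lt_le_trans sx.
  - by apply: moment_integrable_gt; rewrite (lt_le_trans Ms)// (le_trans sx).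
rewrite lt_neqAle le ?lexx ?(ltW st)// andbT; apply/eqP => E.
pose q := nn s / s.
(* The ratio nn(x) / x is nonincreasing and has equal values at s and t, hence is constant between
   them. *)
have lin x : s <= x -> x <= t -> nn x = q * x.
  move=> sx xt; have x0 : 0 < x by exact: lt_le_trans sx.
  have t0 : 0 < t by exact: lt_trans st.
  apply/eqP; rewrite /q mulrAC eq_le; apply/andP; split.
    by rewrite ler_pdivlMr// le// lexx.
  rewrite ler_pdivrMr// -(ler_pM2r t0) mulrAC -E mulrAC [leRHS]mulrAC.
  by rewrite ler_pM2r// le.
pose u := laplacian_moment mu I 0 b.
pose P x := x ^+ n * nn x - (q * n.+1%:R) / n.+1%:R * x ^+ n.+1.
have P0 x : s <= x -> x <= t -> P x = 0.
  by move=> sx xt; rewrite /P lin// mulfK ?pnatr_eq0// (exprS _ n); ring.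
(* P vanishes on [s, t], so by the mean value theorem u takes the value q (n + 1) inside every
   subinterval. *)
have crit x y : s <= x -> x < y -> y <= t -> 
    exists c, [/\ x < c, c < y & u c = q * n.+1%:R].
  move=> sx xy yt.
  have [|c [xc cy]] := @MVT_is_derive R x y P (fun z => z ^+ n * (u z - q * n.+1%:R)) xy.
    move=> z xz zy; apply: (is_derive_sub_power mu mur I M mI IM 0 M sqdist_bound b b0).
    by rewrite (lt_le_trans Ms)// (le_trans sx).
  have sy : s <= y by rewrite (le_trans sx)// ltW.
  have xt : x <= t by rewrite (le_trans (ltW xy)).
  rewrite !P0// subrr => /esym/eqP; rewrite !mulf_eq0 expf_eq0/= !subr_eq0.
  have c0 : 0 < c by rewrite (lt_trans s0)// (le_lt_trans sx).
  by rewrite (gt_eqF c0) (gt_eqF xy) orbF => /eqP uc; exists c.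
pose z := (s + t) / 2.
have [c1 [sc1 c1z u1]] : exists c, [/\ s < c, c < z & u c = q * n.+1%:R].
  by apply: crit; rewrite ?lexx /z//; lra.
have [c2 [zc2 c2t u2]] : exists c, [/\ z < c, c < t & u c = q * n.+1%:R].
  by apply: crit; rewrite ?lexx /z//; lra.
have c12 : c1 < c2 by exact: lt_trans c1z zc2.
(* A second use of the mean value theorem, between c1 and c2, contradicts u' = 2 b (d + 2 b) n_(b-1)
   < 0; the other term of u' carries the factor e = 0. *)
have du x : c1 <= x -> x <= c2 -> is_derive x 1 u
    (2 * b * ((n.+1%:R + 2 * b) * moment mu I 0 (b - 1) 1 x
      - 2 * (b - 1) * 0 * moment mu I 0 (b - 1 - 1) 1 x)).
  move=> c1x _; apply: (is_derive_laplacian_moment mu I M mI IM 0 M sqdist_bound b b0).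
  by rewrite (lt_le_trans Ms)// (le_trans (ltW sc1)).
have [c [c1c cc2]] := MVT_is_derive _ _ _ _ c12 du.
have Mc : M < c by rewrite (lt_trans Ms)// (lt_trans sc1).
have b1 : b - 1 <= 0 by rewrite subr_le0 (le_trans (ltW b0)).
have N0 : 0 < n.+1%:R + 2 * b.
  by rewrite -(natr1 n) -(natr1 k) -addrA -addrA [1 + _]addrA [_ + 2 * b]addrC addrA ltr_wpDl.
have n0 := moment1_gt0 _ _ b1 Mc.
have c0 : 0 < c2 - c1 by rewrite subr_gt0.
rewrite u1 u2 subrr mulr0 mul0r subr0 => /eqP.
by rewrite gt_eqF// pmulr_llt0// pmulr_llt0 ?pmulr_rlt0 ?mulr_gt0.
Qed.

End Bounded.
End Singular.

(** * From velocities to moments; exclusion of two radii *)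

Section Velocity.
Context {R : realType} {k : nat}.
Local Notation n := k.+1.
Context (mu : probability (Rd R n.+1) R) (mur : radially_symmetric mu).
Local Notation e1 := (delta_mx 0 0 : 'rV[R]_n.+1).
Implicit Types (alpha s t a : R).

Lemma gradK_sqdist alpha s (y : 'rV[R]_n.+1) :
  gradK alpha (s *: e1 - y) 0 0 = sqdist 0 s y `^ ((alpha - 2) / 2) * (s - y 0 0) ^+ 1.
Proof.
rewrite /gradK sqdist0E -powR_mulrn ?enorm_ge0// -powRrM.
rewrite (_ : 2 * _ = alpha - 2); last by field.
by rewrite !mxE/= mulr1 expr1.
Qed.

Lemma enorm_scale_e1 s : 0 <= s -> enorm (s *: e1) = s.
Proof.
move=> s0; rewrite /enorm big_ord_recl big1 => [|i _]; rewrite !mxE/=.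
  by rewrite mulr1 addr0 sqrtr_sqr ger0_norm.
by rewrite mulr0 expr0n.
Qed.

Lemma shell_cball M : shell `]-oo, M] = cball M :> set (Rd R n.+1).
Proof. by apply/seteqP; split => y; rewrite /shell /cball/= in_itv. Qed.

(** This is the coordinate of the velocity along e_1, the ball of radius M being the shell of []-oo,
    M]]. *)
Lemma has_velocity_moment alpha s q : s != 0 ->
  has_velocity alpha mu (s *: e1) (q *: (s *: e1)) ->
  (forall M, moment_integrable mu `]-oo, M] ((alpha - 2) / 2) s) /\
  (fun M => - moment mu `]-oo, M] 0 ((alpha - 2) / 2) 1 s) @ +oo --> q * s.
Proof.
move=> s0; rewrite /has_velocity scaler_eq0 (negbTE s0) orFb.
have -> : (e1 == 0) = false.
  by apply/negbTE/eqP => /rowP /(_ 0); rewrite !mxE => /eqP; rewrite oner_eq0.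
move=> /(_ 0)[intf cvgf]; split.
  move=> M; move: (intf M); rewrite -shell_cball /moment_integrable.
  by under [X in EFin \o X]funext do rewrite -gradK_sqdist.
move: cvgf; rewrite !mxE/= mulr1; apply: cvg_trans; apply: near_eq_cvg.
apply: nearW => M; rewrite /moment -shell_cball; congr (- _).
by apply: eq_Rintegral => y _; rewrite gradK_sqdist.
Qed.

Lemma moment_setU (I J : set R) b s : measurable I -> measurable J -> [disjoint I & J] ->
  moment_integrable mu (I `|` J) b s ->
  moment mu (I `|` J) 0 b 1 s = moment mu I 0 b 1 s + moment mu J 0 b 1 s.
Proof.
move=> mI mJ IJ intf; rewrite /moment /shell preimage_setU.
rewrite Rintegral_setU//; try exact: measurable_shell.
rewrite disj_set2E -preimage_setI; move: IJ; rewrite disj_set2E => /eqP ->.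
by rewrite preimage_set0.
Qed.

Section TwoRadii.
Variables (alpha a s t q : R).
Let b := (alpha - 2) / 2.
Hypotheses (b0 : b < 0) (bk : 0 <= k%:R + 2 * b).
Hypotheses (s0 : 0 < s) (sa : s < a) (at_ : a < t).

(** Strictness is available only beyond the radius a, while s < a. An intermediate x in ]a, t[
    combines the weak inequality from s to x with the strict one from x to t. *)
Lemma moment_ball_lt : (0 < mu (cball a))%E ->
  moment_integrable mu `]-oo, a] b s ->
  moment mu `]-oo, a] 0 b 1 t * s < moment mu `]-oo, a] 0 b 1 s * t.
Proof.
move=> mua is_; pose x := (a + t) / 2.
have hb := b0; have hk := bk.
have ax : a < x by move: at_ => h; rewrite /x; lra.
have xt : x < t by move: at_ => h; rewrite /x; lra.
have a0 : 0 < a by exact: lt_trans sa.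
have x0 : 0 < x by exact: lt_trans ax.
have Ia r : `]-oo, a]%classic r -> r <= a by rewrite /= in_itv.
have mI : measurable `]-oo, a]%classic by exact: measurable_itv.
have mua' : (0 < mu (shell `]-oo, a]))%E by rewrite shell_cball.
have h1 := moment1_div_lt mu mur _ mI b a b0 bk Ia a0 mua' x t ax xt.
have h2 := moment1_div_le0 mu mur _ mI b a b0 bk Ia s x s0 (ltW (lt_trans sa ax)) is_
  (moment_integrable_gt mu _ mI b a b0 Ia a0 x ax).
move: h1 h2; move: (moment _ _ _ _ _ t) (moment _ _ _ _ _ x) (moment _ _ _ _ _ s).
move=> T X S h1 h2; rewrite -(ltr_pM2r x0) mulrAC.
rewrite (@lt_le_trans _ _ (X * t * s)) ?ltr_pM2r//.
by rewrite mulrAC [leRHS]mulrAC ler_pM2r// (lt_trans a0).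
Qed.

(** A common q forces n_b(s) t - n_b(t) s, taken over the ball of radius M, to tend to 0. For M > a
    the ball of radius a contributes the fixed [dlt] > 0 and the shell []a, M]] a nonnegative
    amount. The splitting precedes the limit because the velocity is given only as a limit over
    balls. *)
Lemma has_velocity_two_radii : (0 < mu (cball a))%E ->
  has_velocity alpha mu (s *: e1) (q *: (s *: e1)) ->
  has_velocity alpha mu (t *: e1) (q *: (t *: e1)) -> False.
Proof.
move=> mua vs vt.
have t0 : 0 < t by rewrite (lt_trans s0)// (lt_trans sa).
have [is_ cs] := has_velocity_moment _ _ _ (lt0r_neq0 s0) vs.
have [it ct] := has_velocity_moment _ _ _ (lt0r_neq0 t0) vt.
pose m I x := moment mu I 0 b 1 x.
pose dlt := m `]-oo, a]%classic s * t - m `]-oo, a]%classic t * s.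
have dlt0 : 0 < dlt by rewrite subr_gt0; exact: moment_ball_lt.
have lim0 : m `]-oo, M]%classic s * t - m `]-oo, M]%classic t * s @[M --> +oo] --> (0 : R).
  rewrite (_ : 0 = q * t * s - q * s * t); last by ring.
  rewrite (_ : (fun M => _) = fun M => - m `]-oo, M]%classic t * s - - m `]-oo, M]%classic s * t).
    by apply: cvgB; apply: cvgMr_tmp.
  by apply/funext => M; ring.
have : dlt <= 0.
  apply: (cvgr_to_ge lim0); near=> M.
  have aM : a < M by near: M; apply: nbhs_pinfty_gt; exact: num_real.
  have U : `]-oo, M]%classic = `]-oo, a]%classic `|` `]a, M]%classic.
    by rewrite -itv_bndbnd_setU// bnd_simp ltW.
  have m1 : measurable `]-oo, a]%classic by exact: measurable_itv.
  have m2 : measurable `]a, M]%classic by exact: measurable_itv.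
  have disj : [disjoint `]-oo, a]%classic & `]a, M]%classic].
    rewrite disj_set2E; apply/eqP/seteqP; split => // z /=; rewrite !in_itv/=.
    by move=> [za /andP[az _]]; move: za; rewrite leNgt az.
  have iA x : moment_integrable mu `]-oo, M] b x -> moment_integrable mu `]a, M] b x.
    apply: integrableS; [exact: measurable_shell|exact: measurable_shell|].
    by rewrite /shell U => z zI; right.
  have mE x : moment_integrable mu `]-oo, M] b x ->
      m `]-oo, M]%classic x = m `]-oo, a]%classic x + m `]a, M]%classic x.
    by move=> ix; rewrite /m U moment_setU// -U.
  rewrite !mE// /dlt !mulrDl opprD addrACA lerDl subr_ge0.
  apply: (moment1_div_le0 mu mur _ m2 b M b0 bk) => //.
  - by move=> z; rewrite /= in_itv/= => /andP[].
  - by rewrite ltW// (lt_trans sa).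
  - exact: iA.
  - exact: iA.
by rewrite leNgt dlt0.
Unshelve. all: by end_near. Qed.

End TwoRadii.
End Velocity.

(** * Support: rotations and null compact sets *)

Section Support.
Context {R : realType} {d : nat} (mu : probability (Rd R d) R).
Implicit Types (K : set 'rV[R]_d) (x : 'rV[R]_d).

Lemma supp_mulmx (Q : 'M[R]_d) x : radially_symmetric mu ->
  Q *m Q^T = 1%:M -> supp mu x -> supp mu (x *m Q).
Proof.
move=> mur QQ sx U oU Ux.
have mU : measurable (U : set (Rd R d)) by exact: sub_sigma_algebra.
rewrite -(mur Q QQ U mU); apply: sx => //.
by move/continuousP : (mulmx_continuous Q); exact.
Qed.

Lemma measure_bigsetU_eq0 (J : Type) (r : seq J) (F : J -> set (Rd R d)) :
  (forall j, measurable (F j)) -> (forall j, mu (F j) = 0) ->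
  mu (\big[setU/set0]_(j <- r) F j) = 0.
Proof.
move=> mF F0; elim: r => [|j r IHr]; first by rewrite big_nil measure0.
rewrite big_cons null_set_setU//; first exact: bigsetU_measurable.
exact: F0.
Qed.

(** Every point of K has an open null neighbourhood, and finitely many of these cover K. *)
Lemma compact_supp K : compact K -> measurable (K : set (Rd R d)) ->
  (forall x, K x -> ~ supp mu x) -> mu K = 0.
Proof.
move=> cK mK Ks.
(* Points outside K receive the empty set, so that the choice is total and every U x is open and
   null. *)
have /choice[U HU] x : exists U : set 'rV[R]_d, [/\ open U, mu U = 0 & K x -> U x].
  have [Kx|nKx] := pselect (K x); last first.
    by exists set0; split => //.
  have := Ks x Kx => /existsNP[U /not_implyP[oU /not_implyP[Ux /negP]]].
  rewrite -leNgt => U0; exists U; split => //.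
  by apply/eqP; rewrite eq_le U0 measure_ge0.
have mU x : measurable (U x : set (Rd R d)).
  by apply: sub_sigma_algebra; have [] := HU x.
move: cK; rewrite compact_cover => /(_ _ K U)[|x Kx|D' _ KD'].
- by move=> x _; have [] := HU x.
- by exists x => //; have [_ _] := HU x; exact.
move: KD'; rewrite /cover bigcup_fset => KD'.
apply: (@subset_measure0 _ (Rd R d) R mu _ _ _ _ KD') => //; first exact: bigsetU_measurable.
by apply: measure_bigsetU_eq0 => // x; have [] := HU x.
Qed.

End Support.

(** * Shape of the radial part when the support has one positive radius *)

Section Radii.
Context {R : realType} {d : nat} (mu : probability (Rd R d) R).

Lemma radial_part_two_diracs (rho : R) : 0 < rho ->
  (forall x, supp mu x -> enorm x = 0 \/ enorm x = rho) ->
  exists m0 m1 : R, [/\ 0 <= m0, 0 <= m1 &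
    forall I : set R, measurable I ->
      radial_part mu I = (m0%:E * \d_(0%R : R) I + m1%:E * \d_rho I)%E].
Proof.
move=> rho0 srho.
pose Z r : set (Rd R d) := enorm @^-1` [set r].
have mZ r : measurable (Z r).
  rewrite -[Z r]setTI; apply: measurable_enorm => //; exact: measurable_set1.
(* These compact sets miss the support and exhaust the complement of the origin and of the sphere of
   radius rho, which is therefore null. *)
pose K (j : nat) : set (Rd R d) :=
  enorm @^-1` [set r | [/\ j.+1%:R^-1 <= r, r <= j.+1%:R & j.+1%:R^-1 <= `|r - rho|]].
have clo j : closed [set r : R | [/\ j.+1%:R^-1 <= r, r <= j.+1%:R & j.+1%:R^-1 <= `|r - rho|]].
  rewrite (_ : mkset _ = [set r | j.+1%:R^-1 <= r] `&` [set r | r <= j.+1%:R]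
      `&` (fun r => `|r - rho|) @^-1` [set r | j.+1%:R^-1 <= r]); last first.
    by apply/seteqP; split => [r [? ? ?]|r [[? ?] ?]].
  apply: closedI; first by apply: closedI; [exact: closed_ge|exact: closed_le].
  apply: preimage_closed; last exact: closed_ge.
  move=> r _; apply: cvg_norm; apply: cvgB; [exact: cvg_id|exact: cvg_cst].
have cK j : closed (K j : set 'rV[R]_d).
  by apply: preimage_closed => // x _; exact: enorm_continuous.
have mK j : measurable (K j).
  by rewrite -[K j]setCK; apply: measurableC; apply: sub_sigma_algebra; exact: closed_openC.
have K0 j : mu (K j) = 0.
  apply: compact_supp => //.
    apply: bounded_closed_compact => //; exists j.+1%:R; split; first exact: num_real.
    move=> M jM x [_ xj _].
    rewrite /Num.norm/= mx_normrE; apply/bigmax_leP; split.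
      by rewrite (le_trans _ (ltW jM)).
    move=> [a i] _ /=; rewrite ord1 (le_trans (coord_le_enorm _ _))//.
    by rewrite (le_trans xj)// ltW.
  have j0 : 0 < j.+1%:R^-1 :> R by rewrite invr_gt0 ltr0n.
  move=> x [x1 _ x2] /srho[] xE; move: x1 x2; rewrite xE.
    by rewrite leNgt j0.
  by move=> _; rewrite subrr normr0 leNgt j0.
pose N := ~` (Z 0 `|` Z rho).
have mN : measurable N by apply: measurableC; exact: measurableU.
have N0 : mu N = 0.
  suff : mu.-negligible N by move/(negligibleP mu mN).
  apply: (@negligibleS _ _ _ mu (\bigcup_j K j)); last first.
    apply: negligible_bigcup => j; apply/(negligibleP mu (mK j)). exact: K0.
  move=> x /not_orP[/eqP x0 /eqP xr]; have e0 : 0 < enorm x by rewrite lt_def x0 enorm_ge0.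
  have d0 : 0 < `|enorm x - rho| by rewrite normr_gt0 subr_eq0.
  near \oo => j; exists j => //; split.
  - by apply: ltW; near: j; exact: (near_infty_natSinv_lt (PosNum e0)).
  - by rewrite (@le_trans _ _ j%:R) ?ler_nat//; near: j; exact: nbhs_infty_ger.
  - by apply: ltW; near: j; exact: (near_infty_natSinv_lt (PosNum d0)).
exists (fine (mu (Z 0))), (fine (mu (Z rho))).
have fin r : mu (Z r) \is a fin_num by exact: fin_num_measure.
split; rewrite ?fine_ge0 ?measure_ge0// => I mI; rewrite !fineK//.
pose A : set (Rd R d) := enorm @^-1` I.
have mA : measurable A.
  by rewrite -[A]setTI; exact: measurable_enorm.
(* The norm is constant on [Z r], so A contains all of [Z r] or none of it, according to whether r
   lies in I. *)
have diracE r : mu (A `&` Z r) = (mu (Z r) * \d_r I)%E.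
  rewrite /dirac indicE; have [rI|rI] := boolP (r \in I).
    rewrite mule1; congr (mu _); apply/seteqP; split => x; first by case.
    by move=> Zx; split => //; rewrite /A /preimage/= Zx; exact/set_mem.
  rewrite mule0 (_ : _ `&` _ = set0) ?measure0//.
  apply/seteqP; split => // x [/= Ix xr]; move/negP : rI; apply.
  by rewrite -xr; exact/mem_set.
rewrite -!diracE /radial_part /pushforward -/A.
have mAZ r : measurable (A `&` Z r) by exact: measurableI.
rewrite -measureU//; last first.
  apply/seteqP; split => // x [[_ /= x0] [_ /= xr]].
  by move: rho0; rewrite -xr x0 ltxx.
rewrite -setIUr; apply/eqP; rewrite eq_le; apply/andP; split; last first.
  by apply: le_measure; rewrite ?inE//; apply: measurableI => //; exact: measurableU.
have mB : measurable (A `&` (Z 0 `|` Z rho)).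
  by apply: measurableI => //; exact: measurableU.
rewrite -[leRHS]adde0 -N0 (le_trans _ (measureU2 _ mB mN))//.
apply: le_measure; rewrite ?inE//; first exact: measurableU.
by move=> x Ix; have [xZ|xZ] := pselect ((Z 0 `|` Z rho) x); [left|right].
Unshelve. all: by end_near. Qed.

End Radii.

(** * Linear velocity on the initial support *)

Section SimilaritySolution.
Context {R : realType}.

(** Time 0 is not isolated in [0, T0[, so one-sided derivatives at 0 are unique. *)
Lemma time_interval_within_proper (T0 : \bar R) : (0 < T0)%E ->
  ProperFilter (within (time_interval T0) (0 : R)^').
Proof.
move=> T00; apply: Build_ProperFilter_ex => P.
rewrite /within /= => -[e /= e0 eP].
have [t [t0 te tT]] : exists t : R, [/\ 0 < t, t < e & (t%:E < T0)%E].
  clear eP; case: T0 T00 => [T|_|//]; last first.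
    by exists (e / 2); rewrite divr_gt0// ltr_pdivrMr// ltr_pMr// ltr1n ltry.
  rewrite lte_fin => T0; exists (Num.min e T / 2).
  have m0 : 0 < Num.min e T by rewrite lt_min e0.
  have hm : Num.min e T / 2 < Num.min e T by rewrite ltr_pdivrMr// ltr_pMr// ltr1n.
  by rewrite divr_gt0// lte_fin !(lt_le_trans hm)// ge_min lexx ?orbT.
exists t; apply: eP => //=.
- by rewrite sub0r normrN gtr0_norm.
- by rewrite gt_eqF.
- by split => //; exact: ltW.
Qed.

(** At time 0 the curve r(t) x has derivative r'(0) x, which must equal the velocity at x; so q =
    r'(0). *)
Lemma similarity_velocity (d : nat) (alpha : R) (T0 : \bar R) (r : R -> R)
    (mu : R -> probability (Rd R d) R) :
  radial_first_kind_similarity_solution alpha T0 r mu ->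
  exists q : R, forall x, supp (mu 0) x -> has_velocity alpha (mu 0) x (q *: x).
Proof.
move=> [T00 [r0 _ rd] _ _ [w [wv wt]]].
have I0 : time_interval T0 0 by split.
have [q rq] := rd 0 I0; exists q => x sx.
have [_ /(_ 0 I0)] := wt x sx.
rewrite r0 scale1r => dx.
suff <- : w 0 x = q *: x by exact: wv.
have PF := time_interval_within_proper _ T00.
apply: (cvg_unique _ dx); first exact: norm_hausdorff.
rewrite /= (_ : (fun s => _) = fun s => ((s - 0)^-1 * (r s - r 0)) *: x); last first.
  by apply/funext => s; rewrite -scalerBl scalerA.
exact: cvgZr_tmp.
Qed.

End SimilaritySolution.

(** * At most one positive radius in the support *)

Theorem theorem2p2 (R : realType) (d : nat) (alpha : R) (T0 : \bar R)
    (r : R -> R) (mu : R -> probability (Rd R d) R) :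
  (3 <= d)%N ->
  (5 - d%:R <= alpha /\ alpha < 2) \/ alpha = 4 - d%:R ->
  radial_first_kind_similarity_solution alpha T0 r mu ->
  (forall t : R, time_interval T0 t -> is_dilation (r t) (mu 0) (mu t)) /\
  exists m0 m1 rho1 : R,
    [/\ 0 <= m0, 0 <= m1, 0 < rho1 &
      forall I : set R, measurable I -> I `<=` `[0, +oo[ ->
        radial_part (mu 0) I =
          (m0%:E * \d_(0%R : R) I + m1%:E * \d_rho1 I)%E].
Proof.
move=> d3 alphaP sol; have [_ _ mur dil _] := sol; split => //.
have [q vq] := similarity_velocity _ _ _ _ _ sol.
suff [rho rho0 srho] : exists2 rho : R, 0 < rho &
    forall x, supp (mu 0) x -> enorm x = 0 \/ enorm x = rho.
  have [m0 [m1 [m00 m10 muE]]] := radial_part_two_diracs (mu 0) rho rho0 srho.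
  by exists m0, m1, rho; split => // I mI _; exact: muE.
have [[x [sx x0]]|nx] := pselect (exists x, supp (mu 0) x /\ 0 < enorm x); last first.
  (* No positive radius is charged, so rho may be any positive number. *)
  exists 1 => // x sx; left; apply/eqP; rewrite eq_le enorm_ge0 andbT leNgt.
  by apply/negP => x0; apply: nx; exists x.
exists (enorm x) => // y sy.
move: d3 alphaP mu mur dil vq sol x sx x0 y sy.
case: d => [|[|[|k]]] // _ alphaP mu mur dil vq sol x sx x0 y sy.
have N3 : k.+3%:R = k%:R + 3 :> R by rewrite -natrD addn3.
have k0 : 0 <= k%:R :> R by [].
have b0 : (alpha - 2) / 2 < 0.
  rewrite ltr_pdivrMr// mul0r subr_lt0.
  by case: alphaP => [[]//|->]; rewrite N3; lra.
(* With d = k + 3 this reads alpha >= 4 - d, which both alternatives give, the second with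
   equality. *)
have bk : 0 <= k.+1%:R + 2 * ((alpha - 2) / 2).
  rewrite mulrC divfK// -natr1.
  by case: alphaP => [[]|->]; rewrite N3; lra.
have key (u v : 'rV[R]_k.+3) : supp (mu 0) u -> supp (mu 0) v ->
    0 < enorm u -> enorm u < enorm v -> False.
  move=> su sv u0 uv.
  (* An orthogonal map carries z to the ray of e_1, and the support is invariant under it. *)
  have e1v (z : 'rV[R]_k.+3) : supp (mu 0) z ->
      has_velocity alpha (mu 0) (enorm z *: delta_mx 0 0) (q *: (enorm z *: delta_mx 0 0)).
    move=> sz; have [Q QQ zQ] := @orthogonal_transitive R k.+3 z (enorm z *: delta_mx 0 0)
      (esym (enorm_scale_e1 _ (enorm_ge0 z))).
    by apply: vq; rewrite -zQ; exact: supp_mulmx.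
  pose a := (enorm u + enorm v) / 2.
  have ua : enorm u < a by rewrite /a; lra.
  have av : a < enorm v by rewrite /a; lra.
  apply: (has_velocity_two_radii (mu 0) mur alpha a (enorm u) (enorm v) q b0 bk u0 ua av) => //; try exact: e1v.
  (* The open ball of radius a is a neighbourhood of u, a point of the support, so [cball a] has
     positive mass. *)
  have oU : open [set z : 'rV[R]_k.+3 | enorm z < a].
    have /continuousP ce := @enorm_continuous R k.+3.
    have h : open ((enorm : 'rV[R]_k.+3 -> R) @^-1` [set z : R | z < a]).
      by apply: ce; exact: open_lt.
    exact: h.
  apply: lt_le_trans (su _ oU ua) _; apply: le_measure; rewrite ?inE.
  - exact: sub_sigma_algebra.
  - exact: measurable_cball.
  - by move=> z /ltW.
have [y0|y0] := eqVneq (enorm y) 0; [by left|right].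
have {}y0 : 0 < enorm y by rewrite lt_def y0 enorm_ge0.
by have [yx|xy|//] := ltgtP (enorm y) (enorm x);
  [have := key y x sy sx y0 yx|have := key x y sx sy x0 xy].
Qed.
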